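(* Let $d\ge 1$ and $n\ge 2$. Let $G_1,\dots,G_n$ be probability measures on $\mathbb{R}^d$, let $X_1,\dots,X_n$ be independent random vectors with $X_i\sim f_{G_i}$, and let $\bar G_n:=(G_1+\dots+G_n)/n$. Fix $M\ge\sqrt{10\log n}$ and a non-empty compact set $S\subseteq\mathbb{R}^d$, and let $\epsilon_n(M,S,\bar G_n)$ be as defined in the context. Then there exists a positive constant $C_d$ (depending only on $d$) such that for every estimator $\hat f_n$ based on the data $X_1,\dots,X_n$ satisfying $$\prod_{i=1}^n\frac{\hat f_n(X_i)}{f_{\bar G_n}(X_i)}\ \ge\ \exp\left[\frac{C_d(\beta-\alpha)}{\min(1-\alpha,\beta)}\,n\,\epsilon_n^2(M,S,\bar G_n)\right]$$ for some $0<\beta\le\alpha<1$, we have $$\mathbb{P}\left\{\mathfrak{H}(\hat f_n,f_{\bar G_n})\ \ge\ \frac{t\,\epsilon_n(M,S,\bar G_n)\sqrt{C_d}}{\sqrt{\min(1-\alpha,\beta)}}\right\}\le 2n^{-t^2}\qquad\text{for every } t\ge 1,$$ and, moreover, $$\mathbb{E}\,\mathfrak{H}^2(\hat f_n,f_{\bar G_n})\ \le\ \frac{4C_d}{\min(1-\alpha,\beta)}\,\epsilon_n^2(M,S,\bar G_n).$$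
   Context: $\|\cdot\|$ is the Euclidean norm and $\phi_d(z):=(2\pi)^{-d/2}\exp(-\|z\|^2/2)$ is the standard normal density on $\mathbb{R}^d$. For a probability measure $G$ on $\mathbb{R}^d$, $f_G(x):=\int\phi_d(x-\theta)\,dG(\theta)$ is the Gaussian location mixture density with mixing measure $G$; $X_i\sim f_{G_i}$ means that $X_i$ has density $f_{G_i}$. The estimator $\hat f_n$ is a density estimator, regarded as an estimator of $f_{\bar G_n}$. The Hellinger distance $\mathfrak{H}$ is given by $\mathfrak{H}^2(f,g):=\int(\sqrt{f(x)}-\sqrt{g(x)})^2dx$. For non-empty $S\subseteq\mathbb{R}^d$: $\mathfrak{d}_S(x):=\inf_{u\in S}\|x-u\|$, $S^1:=\{x:\mathfrak{d}_S(x)\le 1\}$, and for $p>0$, $\mu_p(\mathfrak{d}_S,G):=\left(\int_{\mathbb{R}^d}\mathfrak{d}_S(\theta)^p\,dG(\theta)\right)^{1/p}$. $\mathrm{Vol}$ is Lebesgue measure. For a probability measure $G$ on $\mathbb{R}^d$, a non-empty compact $S\subseteq\mathbb{R}^d$ and $M\ge\sqrt{10\log n}$, $\epsilon_n(M,S,G)\ge 0$ is defined by $$\epsilon_n^2(M,S,G):=\mathrm{Vol}(S^1)\frac{M^d}{n}\left(\sqrt{\log n}\right)^{d+2}+(\log n)\inf_{p\ge\frac{d+1}{2\log n}}\left(\frac{2\mu_p(\mathfrak{d}_S,G)}{M}\right)^p.$$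
   Formalization: The estimator is required to be jointly measurable with values in the Gaussian location mixture densities; for arbitrary density estimators the claim fails (e.g. averages of very narrow uniforms centred at the data, with all G_i = δ_0 and S = {0}). *)

(* Defs.v *)
From HB Require Import structures.
From mathcomp Require Import all_boot all_order all_algebra.
From mathcomp Require Import all_classical all_reals all_analysis.

Set Implicit Arguments.
Unset Strict Implicit.
Unset Printing Implicit Defensive.

Import Order.TTheory GRing.Theory Num.Theory.
Import numFieldNormedType.Exports.

Local Open Scope classical_set_scope.
Local Open Scope ring_scope.

(* The Borel sigma-algebra of R^d, generated by the coordinate maps as the
   library does for n.-tuple. *)
Definition rV_display : measure_display.
Proof. exact: default_measure_display. Qed.

Section rV_measurable.
Context (R : realType) (d : nat).

Let coord (i : 'I_d) (x : 'rV[R]_d) : R := x ord0 i.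

Let rV_set0 : g_sigma_preimage coord set0.
Proof. exact: sigma_algebra0. Qed.

Let rV_setC A : g_sigma_preimage coord A -> g_sigma_preimage coord (~` A).
Proof. exact: sigma_algebraC. Qed.

Let rV_bigcup (F : (set 'rV[R]_d)^nat) : (forall i, g_sigma_preimage coord (F i)) ->
  g_sigma_preimage coord (\bigcup_i (F i)).
Proof. exact: sigma_algebra_bigcup. Qed.

HB.instance Definition _ := @isMeasurable.Build rV_display
  'rV[R]_d (g_sigma_preimage coord) rV_set0 rV_setC rV_bigcup.

End rV_measurable.

Lemma measurable_rV_coord (R : realType) d (i : 'I_d) :
  measurable_fun [set: 'rV[R]_d] (fun x => x ord0 i).
Proof.
move=> _ Y mY; rewrite setTI; apply: sub_sigma_algebra => /=.
rewrite -bigcup_seq/=; exists i => /=; first by rewrite mem_index_enum.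
by exists Y => //; rewrite setTI.
Qed.

Lemma measurable_fun_rVP (R : realType) d d1 (T : measurableType d1)
    (f : T -> 'rV[R]_d) :
  measurable_fun [set: T] f <->
  forall i, measurable_fun [set: T] (fun t => f t ord0 i).
Proof.
split=> [mf i|mf].
  exact: (measurableT_comp (measurable_rV_coord i) mf).
have H : @g_sigma_preimage _ R 'rV[R]_d d (fun i x => x ord0 i) `<=`
    [set A | measurable (f @^-1` A)].
  apply: smallest_sub.
    split=> /=; first by rewrite preimage_set0.
    - by move=> A mA; rewrite setTD preimage_setC; exact: measurableC.
    - by move=> F mF; rewrite preimage_bigcup; exact: bigcup_measurable.
  move=> A /=; rewrite -bigcup_seq/= => -[i _ [B mB <-]].
  have := mf i measurableT B mB.
  by rewrite setTI setTI.
by move=> _ A mA; rewrite setTI; exact: H.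
Qed.

Section lebesgue_rV.
Context (R : realType).

Definition rV_cons d (z : measurableTypeR R * 'rV[R]_d) : 'rV[R]_d.+1 :=
  row_mx (z.1%:M : 'rV[R]_1) z.2.

Lemma rV_cons0 d z : @rV_cons d z ord0 ord0 = z.1.
Proof.
have -> : ord0 = lshift d (ord0 : 'I_1) :> 'I_d.+1 by exact/val_inj.
by apply: (etrans (row_mxEl _ _ _ _)); rewrite mxE.
Qed.

Lemma rV_consS d z i : @rV_cons d z ord0 (lift ord0 i) = z.2 ord0 i.
Proof.
have -> : lift ord0 i = rshift 1 i :> 'I_d.+1 by exact/val_inj.
exact: row_mxEr.
Qed.

Definition rV_uncons d (x : 'rV[R]_d.+1) : measurableTypeR R * 'rV[R]_d :=
  (x ord0 ord0, \row_i x ord0 (lift ord0 i)).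

Lemma rV_consK d : cancel (@rV_cons d) (@rV_uncons d).
Proof.
move=> z; rewrite /rV_uncons rV_cons0 [RHS]surjective_pairing; congr pair.
by apply/rowP => i; rewrite mxE rV_consS.
Qed.

Lemma rV_unconsK d : cancel (@rV_uncons d) (@rV_cons d).
Proof.
move=> x; apply/rowP => i.
case: (unliftP ord0 i) => [j|] ->; last by rewrite rV_cons0.
by rewrite rV_consS mxE.
Qed.

Lemma measurable_rV_cons d : measurable_fun setT (@rV_cons d).
Proof.
apply/measurable_fun_rVP => i.
case: (unliftP ord0 i) => [j|] ->.
  under eq_fun do rewrite rV_consS.
  exact: (measurableT_comp (measurable_rV_coord j) measurable_snd).
under eq_fun do rewrite rV_cons0.
exact: measurable_fst.
Qed.

Lemma measurable_rV_uncons d : measurable_fun setT (@rV_uncons d).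
Proof.
apply: measurable_fun_pair; first exact: measurable_rV_coord.
apply/measurable_fun_rVP => i.
under eq_fun do rewrite mxE.
exact: measurable_rV_coord.
Qed.


Definition lebesgue_cons d (m : {sigma_finite_measure set 'rV[R]_d -> \bar R}) :=
  pushforward (@lebesgue_measure R \x m)%E (@rV_cons d).

Section lebesgue_cons.
Variables (d : nat) (m : {sigma_finite_measure set 'rV[R]_d -> \bar R}).

Let mcons A : measurable A -> measurable (@rV_cons d @^-1` A).
Proof.
by move=> mA; rewrite -[X in measurable X]setTI; exact: measurable_rV_cons.
Qed.

Let lebesgue_cons0 : lebesgue_cons m set0 = 0%E.
Proof. by rewrite /lebesgue_cons /pushforward preimage_set0 measure0. Qed.

Let lebesgue_cons_ge0 A : (0 <= lebesgue_cons m A)%E.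
Proof. exact: (measure_ge0 (@lebesgue_measure R \x m)%E). Qed.

Let lebesgue_cons_sigma_additive : semi_sigma_additive (lebesgue_cons m).
Proof.
move=> F mF tF mUF; rewrite /lebesgue_cons /pushforward preimage_bigcup.
apply: measure_semi_sigma_additive.
- by move=> n; exact: mcons.
- apply/trivIsetP => /= i j _ _ ij; rewrite -preimage_setI.
  by move/trivIsetP : tF => /(_ _ _ _ _ ij) ->//; rewrite preimage_set0.
- by rewrite -preimage_bigcup; exact: mcons.
Qed.

HB.instance Definition _ := isMeasure.Build _ _ _ (lebesgue_cons m)
  lebesgue_cons0 lebesgue_cons_ge0 lebesgue_cons_sigma_additive.

Let lebesgue_cons_sigma_finite : sigma_finite setT (lebesgue_cons m).
Proof.
have /sigma_finiteP[F [TF ndF Foo]] := sigma_finiteT (@lebesgue_measure R).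
have /sigma_finiteP[G [TG ndG Goo]] := sigma_finiteT m.
exists (fun k => @rV_uncons d @^-1` (F k `*` G k)).
  rewrite -preimage_bigcup -[LHS](preimage_setT (@rV_uncons d)).
  congr (_ @^-1` _).
  rewrite -setXTT TF TG predeqE => -[x y]; split.
    move=> [/= [i _ Fix] [k _ Gky]]; exists (maxn i k) => //; split.
    - by move: x Fix; exact/subsetPset/ndF/leq_maxl.
    - by move: y Gky; exact/subsetPset/ndG/leq_maxr.
  by move=> [i _ []/= ? ?]; split; exists i.
move=> k; have [mF Fkoo] := Foo k; have [mG Gkoo] := Goo k; split.
  rewrite -[X in measurable X]setTI.
  by apply: measurable_rV_uncons => //; exact: measurableX.
rewrite /lebesgue_cons /pushforward -comp_preimage (_ : _ \o _ = id)//.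
  by rewrite preimage_id product_measure1E// lte_mul_pinfty// ge0_fin_numE.
by apply/funext => z /=; rewrite rV_consK.
Qed.

HB.instance Definition _ := @Measure_isSigmaFinite.Build _ _ _
  (lebesgue_cons m) lebesgue_cons_sigma_finite.

End lebesgue_cons.

(* Lebesgue measure on R^d, by induction on d through R^(d+1) = R x R^d; it is
   characterized on boxes by lebesgue_rV_box. *)
Fixpoint lebesgue_rV d : {sigma_finite_measure set 'rV[R]_d -> \bar R} :=
  if d is d'.+1 then lebesgue_cons (lebesgue_rV d') else \d_(0 : 'rV[R]_0).

Lemma lebesgue_rV_box d (A : 'I_d -> set R) : (forall i, measurable (A i)) ->
  lebesgue_rV d [set x | forall i, A i (x ord0 i)] =
  (\prod_(i < d) @lebesgue_measure R (A i))%E.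
Proof.
elim: d A => [|d IH] A mA.
  by rewrite big_ord0 /= diracE mem_set// => -[].
rewrite big_ord_recl -IH//=.
have mB : measurable [set x : 'rV[R]_d | forall i, A (lift ord0 i) (x ord0 i)].
  rewrite (_ : [set _ | _] = \bigcap_(i in [set: 'I_d])
    ((fun x : 'rV[R]_d => x ord0 i) @^-1` A (lift ord0 i))).
    apply: fin_bigcap_measurable => // i _.
    by rewrite -[X in measurable X]setTI; exact: measurable_rV_coord.
  by apply/seteqP; split => [x/= Ax i _|x/= Ax i]; exact: Ax.
rewrite -product_measure1E//; last exact: mA.
rewrite /lebesgue_cons /pushforward.
congr (_ _); apply/seteqP; split => [z/= Az|z/= [A0 AS] i].
  split; first by have := Az ord0; rewrite rV_cons0.
  by move=> i; have := Az (lift ord0 i); rewrite rV_consS.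
case: (unliftP ord0 i) => [j|] ->; last by rewrite rV_cons0.
by rewrite rV_consS; exact: AS.
Qed.

End lebesgue_rV.

Section mean_measure.
Local Open Scope ereal_scope.
Context d (T : measurableType d) (R : realType) (n : nat).
Variable G : 'I_n -> probability T R.

Definition mean_measure (A : set T) : \bar R :=
  (n%:R^-1)%:E * \sum_(i < n) G i A.

Let mean_measure0 : mean_measure set0 = 0.
Proof. by rewrite /mean_measure big1 ?mule0. Qed.

Let mean_measure_ge0 A : 0 <= mean_measure A.
Proof. by rewrite mule_ge0 ?sume_ge0// lee_fin invr_ge0. Qed.

Let mean_measure_sigma_additive : semi_sigma_additive mean_measure.
Proof.
pose m k : {measure set T -> \bar R} :=
  if insub k is Some i then G i else mzero.
have r0 : (0 <= n%:R^-1 :> R)%R by rewrite invr_ge0.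
rewrite (_ : mean_measure = mscale (NngNum r0) (msum m n)).
  exact: measure_semi_sigma_additive.
apply/funext => A; rewrite /mean_measure /mscale /msum/=; congr (_ * _).
by apply: eq_bigr => i _; rewrite /m valK.
Qed.

HB.instance Definition _ := isMeasure.Build _ _ _ mean_measure
  mean_measure0 mean_measure_ge0 mean_measure_sigma_additive.

Lemma mean_measure_setT : (0 < n)%N -> mean_measure setT = 1.
Proof.
move=> n0; rewrite /mean_measure (eq_bigr (fun=> 1%:E)); last first.
  by move=> i _; rewrite probability_setT.
rewrite sumEFin sumr_const card_ord -EFinM mulVf//.
by rewrite pnatr_eq0 -lt0n.
Qed.

End mean_measure.

Section gaussian_location_mixture.
Context (R : realType) (d : nat).
Implicit Types (x z : 'rV[R]_d) (S : set 'rV[R]_d).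
Implicit Types (G : {measure set 'rV[R]_d -> \bar R}) (f g : 'rV[R]_d -> R).

(* The norm `|x| of the library on 'rV[R]_d is the sup norm. *)
Definition enorm x : R := Num.sqrt (\sum_(i < d) x ord0 i ^+ 2).

Definition std_normal_density z : R :=
  (2 * pi) `^ (- (d%:R / 2)) * expR (- enorm z ^+ 2 / 2).

Definition mixture_density G x : R :=
  \int[G]_theta std_normal_density (x - theta).

Definition is_mixture_density f :=
  exists G : probability 'rV[R]_d R, f = mixture_density G.

Definition set_dist S x : R := inf [set enorm (x - u) | u in S].

Definition enlargement1 S : set 'rV[R]_d := [set x | set_dist S x <= 1].

Definition moment S G (p : R) : \bar R :=
  ((\int[G]_theta (set_dist S theta `^ p)%:E) `^ p^-1)%E.

(* Extended-real valued: it is +oo when no moment of G is finite. *)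
Definition epsilon2 (n : nat) (M : R) S G : \bar R :=
  (@lebesgue_rV R d (enlargement1 S) *
     (M ^+ d / n%:R * Num.sqrt (ln n%:R) ^+ (d + 2))%:E +
   (ln n%:R)%:E *
     ereal_inf [set ((2 / M)%:E * moment S G p) `^ p
               | p in [set p : R | (d.+1)%:R / (2 * ln n%:R) <= p]%R])%E.

Definition epsilon (n : nat) (M : R) S G : \bar R := sqrte (epsilon2 n M S G).

Definition hellinger2 f g : \bar R :=
  (\int[@lebesgue_rV R d]_x ((Num.sqrt (f x) - Num.sqrt (g x)) ^+ 2)%:E)%E.

Definition hellinger f g : \bar R := sqrte (hellinger2 f g).

(* An estimator of a Gaussian location mixture density: a jointly measurable
   function of the data and of the argument of the density, with values in the
   class of Gaussian location mixture densities. *)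
Definition mixture_estimator (n : nat)
    (fhat : n.-tuple 'rV[R]_d -> 'rV[R]_d -> R) :=
  measurable_fun setT
    (fun z : n.-tuple 'rV[R]_d * 'rV[R]_d => fhat z.1 z.2) /\
  forall x : n.-tuple 'rV[R]_d, is_mixture_density (fhat x).

End gaussian_location_mixture.

Section random_vectors.
Context (R : realType) (d : nat) (disp : measure_display).
Context (Omega : measurableType disp) (P : probability Omega R).

Definition has_density (X : {RV P >-> 'rV[R]_d}) (f : 'rV[R]_d -> R) :=
  forall A : set 'rV[R]_d, measurable A ->
    distribution P X A = (\int[@lebesgue_rV R d]_(x in A) (f x)%:E)%E.

Definition mutually_independent (n : nat) (X : 'I_n -> {RV P >-> 'rV[R]_d}) :=
  forall (J : {set 'I_n}) (A : 'I_n -> set 'rV[R]_d),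
    (forall i, measurable (A i)) ->
    P (\bigcap_(i in [set` J]) (X i @^-1` A i)) =
    (\prod_(i in J) P (X i @^-1` A i))%E.

Definition sample (n : nat) (X : 'I_n -> {RV P >-> 'rV[R]_d}) (w : Omega) :
  n.-tuple 'rV[R]_d := [tuple X i w | i < n].

End random_vectors.

(* Main.v *)
Require Import Defs.
From HB Require Import structures.
From mathcomp Require Import all_boot all_order all_algebra.
From mathcomp Require Import all_classical all_reals all_analysis.
From mathcomp Require Import measurable_realfun ring lra.

(** Write f0 for the density of the mean mixing measure, h for the estimated
    density, H for the Hellinger distance and T for a multiple of
    t^2 epsilon^2 / min(1 - alpha, beta). The claim is that a mixture density with
    H^2(h, f0) >= T can have a likelihood ratio above e^(-(alpha - beta) n T)
    only with a small probability, although h depends on the data.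

    For a fixed h this is the Chernoff bound with exponent 1/2: the expectation of
    the product of the square roots of h(X_i) / f0(X_i) is at most
    e^(n (A - 1)), where A = 1 - H^2/2 is the integral of sqrt h * sqrt f0
    (chernoff_product). The observations are not identically distributed, but the
    inequality x <= e^(x - 1) leaves only the average f0 of their densities.

    The dependence on the data is removed by a union bound over finitely many
    representatives. The Gaussian kernel, expanded around a point, has a remainder
    which is small near this point, uniformly in the centre of the Gaussian
    (gauss_kernel_remainder). On a box whose half-width is the square root of
    ln n, a mixture density is thus determined up to n^-2 by about (ln n)^d
    coefficients. Rounding them around the points of a grid in the M-enlargement
    of S encodes a mixture density there with a number of codes whose logarithm is
    of the order of the first term of n epsilon^2 (mixture_entropy).

    Outside the M-enlargement the code says nothing, and h is only known to be at
    most 1. There, 1 is written as the product of an integrable envelope of order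
    n^-2 and of e^(2 ln n * log_tail) (envelope_dominates). The envelope perturbs
    the affinity A by O(1 / n). The product of the factors e^(2 ln n * log_tail(X_i))
    is large with a small probability, by the Chernoff bound with exponent
    1 / (2 ln n): this exponent leaves the integral of e^log_tail against f0, which
    exceeds 1 by at most a moment of the distance to S and a term of order 1 / n,
    thanks to M^2 >= 10 ln n (tail_integral). This is the second term of epsilon^2.

    The likelihood is split between the two products by hellinger_deviation, and
    hellinger_tail collects the constants. Using t = sqrt k for k = 1, 2, ... in the
    deviation inequality gives the bound on the expectation
    (expectation_step_bound). If epsilon is infinite, there is nothing to prove,
    since H^2 <= 2. *)

Set Implicit Arguments.
Unset Strict Implicit.
Unset Printing Implicit Defensive.

Import Order.TTheory GRing.Theory Num.Theory.
Import numFieldNormedType.Exports.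

Local Open Scope classical_set_scope.
Local Open Scope ring_scope.

(** * Expansion of the Gaussian kernel *)

Lemma exprn_fact_le_expR (R : realType) (x : R) k : 0 <= x ->
  x ^+ k / k`!%:R <= expR x.
Proof.
move=> x0; case: k => [|k].
  by rewrite expr0 fact0 divr1 -expR0 ler_expR.
by apply: le_trans (expR_ge1Dxn k x0); rewrite lerDr.
Qed.

Lemma fact_gt0R (R : realType) k : 0 < k`!%:R :> R.
Proof. by rewrite ltr0n fact_gt0. Qed.

Lemma series_exp_coeff_le (R : realType) (x : R) N : 0 <= x ->
  series (exp_coeff x) N <= expR x.
Proof.
move=> x0; apply: nondecreasing_cvgn_le; last exact: is_cvg_series_exp_coeff.
by apply: nondecreasing_series => i _ _; exact: exp_coeff_ge0.
Qed.

(** The tail of the exponential series is dominated term by term, because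
    (K + i)! >= K! i! factors |x|^K / K! out of it. *)
Lemma expR_taylor (R : realType) (x : R) K :
  `|expR x - \sum_(k < K) x ^+ k / k`!%:R| <=
  `|x| ^+ K / K`!%:R * expR `|x|.
Proof.
have cvgD : (fun N => `|series (exp_coeff x) N - \sum_(k < K) x ^+ k / k`!%:R|) @ \oo
    --> `|expR x - \sum_(k < K) x ^+ k / k`!%:R|.
  apply: (@cvg_norm _ R^o).
  apply: (@cvgB _ R^o); last exact: cvg_cst.
  exact: is_cvg_series_exp_coeff.
rewrite -(cvg_lim _ cvgD)//; apply: limr_le; first by apply/cvg_ex; eexists; exact: cvgD.
near=> N.
have KN : (K <= N)%N by near: N; exists K.
rewrite /series/= -(big_mkord predT (fun k => x ^+ k / k`!%:R)).
rewrite [X in X - _](big_cat_nat (leq0n K) KN)/= addrAC subrr add0r -{1}(add0n K) big_addn.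
apply: le_trans (ler_norm_sum _ _ _) _.
apply: (@le_trans _ _ (\sum_(0 <= i < N - K) `|x| ^+ K / K`!%:R * exp_coeff `|x| i)); last first.
  rewrite -mulr_sumr ler_wpM2l ?divr_ge0 ?exprn_ge0//.
  exact: series_exp_coeff_le.
apply: ler_sum => i _.
rewrite /exp_coeff/= normrM normfV normrX normr_nat exprD mulrACA.
rewrite mulrC [leRHS]mulrC (mulrC (_ ^+ i)) ler_wpM2r ?mulr_ge0 ?exprn_ge0//.
rewrite -invfM lef_pV2 ?posrE ?mulr_gt0 ?fact_gt0R// -natrM ler_nat.
have := bin_fact (leq_addl i K); rewrite addnK => <-.
by rewrite leq_pmull// bin_gt0 leq_addl.
Unshelve. all: by end_near. Qed.

(** The normalisation by the square root of k! is the one for which these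
    functions are bounded by 1 (as u^(2k) / k! <= e^(u^2)), and for which the same
    functions appear on both sides of the expansion of e^(-(y+u)^2/2): as
    coefficients, depending on y, and as basis functions of u. *)
Definition gauss_monomial (R : realType) (k : nat) (u : R) : R :=
  u ^+ k * expR (- u ^+ 2 / 2) / Num.sqrt k`!%:R.

Lemma gauss_monomial_le1 (R : realType) k (u : R) : `|gauss_monomial k u| <= 1.
Proof.
rewrite -[leRHS]ger0_norm// -ler_sqr ?nnegrE// !real_normK ?num_real// expr1n.
rewrite /gauss_monomial !exprMn exprVn sqr_sqrtr ?ler0n// -exprM mulnC exprM.
rewrite -expRM_natl (_ : expR _ = (expR (u ^+ 2))^-1); last first.
  by rewrite -expRN; congr expR; lra.
rewrite mulrAC ler_pdivrMr ?expR_gt0// mul1r.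
by rewrite exprn_fact_le_expR ?sqr_ge0.
Qed.

Lemma measurable_gauss_monomial (R : realType) k :
  measurable_fun [set: R] (gauss_monomial k).
Proof.
apply: measurable_funM => //; apply: measurable_funM => //.
apply: measurableT_comp => //; apply: measurable_funM => //.
by apply: measurableT_comp => //; exact: measurable_funX.
Qed.

(** e^(-(y+u)^2/2) = e^(-y^2/2) e^(-u^2/2) e^(-yu); only the last factor is
    expanded. *)
Lemma gauss_kernel_factor (R : realType) (y u : R) K :
  expR (- (y + u) ^+ 2 / 2) - \sum_(k < K) (-1) ^+ k * gauss_monomial k y * gauss_monomial k u
  = expR (- y ^+ 2 / 2) * expR (- u ^+ 2 / 2) *
    (expR (- (y * u)) - \sum_(k < K) (- (y * u)) ^+ k / k`!%:R).
Proof.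
rewrite mulrBr -!expRD; congr (_ - _); first by congr expR; lra.
rewrite mulr_sumr; apply: eq_bigr => k _.
rewrite /gauss_monomial (exprNn (y * u)) exprMn.
rewrite -[in RHS](sqr_sqrtr (ler0n _ k`!)) expRD.
have : Num.sqrt k`!%:R != 0 :> R by rewrite sqrtr_eq0 -ltNge fact_gt0R.
by move=> ?; field.
Qed.

(** The bound is uniform in y. In the squared Taylor remainder, 2|yu| is at most
    y^2/2 + 2 u^2, which leaves a factor e^(-y^2/2); this factor absorbs one of the
    two copies of (y^2/2)^K / K!. *)
Lemma gauss_kernel_remainder (R : realType) (y u : R) K :
  (`|expR (- (y + u) ^+ 2 / 2) -
     \sum_(k < K) (-1) ^+ k * gauss_monomial k y * gauss_monomial k u|) ^+ 2 <=
  (2 * u ^+ 2) ^+ K / K`!%:R * expR (u ^+ 2).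
Proof.
rewrite gauss_kernel_factor normrM ger0_norm ?mulr_ge0 ?expR_ge0//.
apply: (@le_trans _ _ ((expR (- y ^+ 2 / 2) * expR (- u ^+ 2 / 2) *
  (`|y * u| ^+ K / K`!%:R * expR `|y * u|)) ^+ 2)).
  rewrite ler_sqr ?nnegrE ?mulr_ge0 ?expR_ge0 ?invr_ge0 ?ler0n ?exprn_ge0//.
  rewrite ler_wpM2l ?mulr_ge0 ?expR_ge0//.
  by apply: le_trans (expR_taylor _ K) _; rewrite normrN.
set rhs := leRHS; rewrite !exprMn -!expRM_natl exprVn -exprM mulnC exprM real_normK ?num_real//.
have yu : `|y * u| <= y ^+ 2 / 4 + u ^+ 2.
  rewrite normrM -(real_normK (num_real y)) -(real_normK (num_real u)).
  by have := sqr_ge0 (`|y| / 2 - `|u|); nra.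
apply: (@le_trans _ _ (expR (- (y ^+ 2 / 2)) * expR (u ^+ 2) *
   (((y * u) ^+ 2) ^+ K / K`!%:R ^+ 2))).
  rewrite [leLHS](_ : _ = (expR (2 * (- y ^+ 2 / 2)) * expR (2 * (- u ^+ 2 / 2)) * expR (2 * `|y * u|)) *
   (((y * u) ^+ 2) ^+ K / K`!%:R ^+ 2)); last by lra.
  rewrite ler_wpM2r ?divr_ge0 ?sqr_ge0//; first by rewrite exprn_ge0// sqr_ge0.
  rewrite -!expRD ler_expR.
  by lra.
have := @exprn_fact_le_expR _ (y ^+ 2 / 2) K; rewrite divr_ge0 ?sqr_ge0// => /(_ isT) H.
rewrite /rhs (_ : (y * u) ^+ 2 = (2 * u ^+ 2) * (y ^+ 2 / 2)); last by lra.
rewrite [(_ * (y ^+ 2 / 2)) ^+ K]exprMn.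
rewrite [leLHS](_ : _ = ((2 * u ^+ 2) ^+ K / K`!%:R * expR (u ^+ 2)) *
  ((expR (y ^+ 2 / 2))^-1 * ((y ^+ 2 / 2) ^+ K / K`!%:R))); last first.
  by rewrite expRN expr2 invfM; set a := (y ^+ 2 / 2) ^+ K; lra.
rewrite ler_piMr//.
  by rewrite mulr_ge0 ?expR_ge0 ?divr_ge0// exprn_ge0// mulr_ge0 ?sqr_ge0.
by rewrite mulrC ler_pdivrMr ?expR_gt0// mul1r.
Qed.

(** Telescoping: the factors are exchanged one at a time. As |B i| <= 2, each
    exchange doubles the constant. *)
Lemma ler_norm_prodB (R : realDomainType) d (A B : 'I_d -> R) (delta : R) :
  0 <= delta -> delta <= 1 ->
  (forall i, `|A i| <= 1) -> (forall i, `|A i - B i| <= delta) ->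
  `|\prod_i A i - \prod_i B i| <= 2 ^+ d * delta.
Proof.
move=> d0 d1 hA hAB.
suff : `|\prod_i A i - \prod_i B i| <= (2 ^+ d - 1) * delta.
  by move/le_trans; apply; rewrite ler_wpM2r// gerBl.
elim: d A B hA hAB => [|d IH] A B hA hAB.
  by rewrite !big_ord0 !subrr normr0 mul0r.
rewrite !big_ord_recl.
set PA := \prod_(i < d) _; set PB := \prod_(i < d) _.
have hP : `|PA - PB| <= (2 ^+ d - 1) * delta by apply: IH.
have hB : `|PB| <= 2 ^+ d.
  rewrite normr_prod -[in leRHS](card_ord d) -prodr_const.
  apply: ler_prod => i _; rewrite normr_ge0/=.
  rewrite -[B _](subrK (A (lift ord0 i))) (le_trans (ler_normD _ _))//.
  rewrite distrC; have := hAB (lift ord0 i); have := hA (lift ord0 i); lra.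
rewrite (_ : _ - _ = A ord0 * (PA - PB) + (A ord0 - B ord0) * PB); last by lra.
rewrite (le_trans (ler_normD _ _))// !normrM exprS.
have h1 : `|A ord0| * `|PA - PB| <= (2 ^+ d - 1) * delta.
  by apply: le_trans hP; rewrite ler_piMl.
have h2 : `|A ord0 - B ord0| * `|PB| <= delta * 2 ^+ d by rewrite ler_pM.
lra.
Qed.

Definition gauss_monomial_prod (R : realType) d K (k : {ffun 'I_d -> 'I_K})
  (u : 'I_d -> R) : R := \prod_i gauss_monomial (k i) (u i).

Lemma gauss_monomial_prod_le1 (R : realType) d K (k : {ffun 'I_d -> 'I_K})
  (u : 'I_d -> R) : `|gauss_monomial_prod k u| <= 1.
Proof.
rewrite normr_prod; apply: (@le_trans _ _ (\prod_(i < d) 1)); last by rewrite big1.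
by apply: ler_prod => i _; rewrite normr_ge0 gauss_monomial_le1.
Qed.

Lemma gauss_kernel_approx (R : realType) d K (delta : R) (y u : 'I_d -> R) :
  0 <= delta -> delta <= 1 ->
  (forall i, (2 * u i ^+ 2) ^+ K / K`!%:R * expR (u i ^+ 2) <= delta ^+ 2) ->
  `|\prod_i expR (- (y i + u i) ^+ 2 / 2) -
    \sum_(k : {ffun 'I_d -> 'I_K})
      (\prod_i ((-1) ^+ k i) * gauss_monomial_prod k y) * gauss_monomial_prod k u| <=
  2 ^+ d * delta.
Proof.
move=> d0 d1 hu.
rewrite (_ : \sum_k _ = \prod_i \sum_(k < K)
    (-1) ^+ k * gauss_monomial k (y i) * gauss_monomial k (u i)); last first.
  by rewrite bigA_distr_bigA; apply: eq_bigr => k _; rewrite -!big_split.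
apply: ler_norm_prodB => // i.
  rewrite ger0_norm ?expR_ge0// -expR0 ler_expR mulNr oppr_le0.
  by rewrite divr_ge0 ?sqr_ge0.
rewrite -ler_sqr ?nnegrE//; apply: le_trans (hu i).
exact: gauss_kernel_remainder.
Qed.

(** Since K^K / K! <= e^K, the remainder is at most (2 e L / K)^K e^L, and
    K >= 2 e^3 L makes the base at most e^-2. *)
Lemma gauss_remainder_small (R : realType) (L u : R) K : 0 < L -> u ^+ 2 <= L ->
  2 * expR 3 * L <= K%:R ->
  (2 * u ^+ 2) ^+ K / K`!%:R * expR (u ^+ 2) <= expR (- K%:R + L / 2) ^+ 2.
Proof.
move=> L0 uL KL.
have K0 : 0 < K%:R :> R by apply: lt_le_trans KL; rewrite !mulr_gt0 ?expR_gt0.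
rewrite (_ : expR _ ^+ 2 = expR (- 2 * K%:R) * expR L); last first.
  by rewrite -expRM_natl -expRD; congr expR; lra.
rewrite ler_pM ?expR_ge0 ?ler_expR//.
  by rewrite divr_ge0// exprn_ge0// mulr_ge0 ?sqr_ge0.
rewrite ler_pdivrMr ?fact_gt0R//.
have := exprn_fact_le_expR K (ltW K0); rewrite ler_pdivrMr ?fact_gt0R// => H.
apply: (@le_trans _ _ (expR (- 3 * K%:R) * K%:R ^+ K)); last first.
  rewrite (_ : - 3 * K%:R = - 2 * K%:R - K%:R); last by lra.
  rewrite expRD -mulrA ler_wpM2l ?expR_ge0// expRN mulrC ler_pdivrMr ?expR_gt0//.
  by rewrite mulrC.
rewrite (mulrC (-3)) expRM_natl -exprMn lerXn2r ?nnegrE//.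
- by rewrite mulr_ge0// sqr_ge0.
have -> : expR (-3) = (expR 3)^-1 :> R by rewrite -expRN.
rewrite ler_pdivlMl ?expR_gt0//.
by apply: le_trans KL; have := expR_gt0 (3 : R); nra.
Qed.

(** * Euclidean distance and measurability *)

Section euclidean_norm.
Context (R : realType) (d : nat).
Implicit Types (x y : 'rV[R]_d) (S : set 'rV[R]_d).

Lemma enorm_ge0 x : 0 <= enorm x.
Proof. exact: sqrtr_ge0. Qed.

Lemma sqr_enorm x : enorm x ^+ 2 = \sum_i x ord0 i ^+ 2.
Proof. by rewrite sqr_sqrtr// sumr_ge0// => i _; exact: sqr_ge0. Qed.

Lemma enormN x : enorm (- x) = enorm x.
Proof. by congr Num.sqrt; apply: eq_bigr => i _; rewrite mxE sqrrN. Qed.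

(** Lagrange's identity: the defect is half the sum of the squares
    (a i * b j - a j * b i)^2. *)
Lemma cauchy_schwarz_rV x y :
  \sum_i x ord0 i * y ord0 i <= enorm x * enorm y.
Proof.
apply: ler_normlW; rewrite -ler_sqr ?nnegrE ?mulr_ge0 ?enorm_ge0//.
rewrite real_normK ?num_real// exprMn !sqr_enorm expr2.
set a := fun i => x ord0 i; set b := fun i => y ord0 i.
have : 0 <= \sum_i \sum_j (a i * b j - a j * b i) ^+ 2.
  by apply: sumr_ge0 => i _; apply: sumr_ge0 => j _; exact: sqr_ge0.
under eq_bigr do under eq_bigr do rewrite sqrrB !exprMn.
under eq_bigr do rewrite !big_split/= -mulr_sumr -mulr_suml sumrN.
rewrite !big_split/= -mulr_suml -mulr_sumr sumrN.
rewrite (_ : \sum_i \sum_j _ *+ 2 = (\sum_i a i * b i) * (\sum_i a i * b i) *+ 2).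
  by rewrite /a /b; nra.
rewrite mulr_suml -sumrMnl; apply: eq_bigr => i _.
rewrite mulr_sumr -sumrMnl; apply: eq_bigr => j _.
by congr (_ *+ 2); lra.
Qed.

Lemma enormD x y : enorm (x + y) <= enorm x + enorm y.
Proof.
rewrite -ler_sqr ?nnegrE ?addr_ge0 ?enorm_ge0// sqrrD !sqr_enorm.
under eq_bigr do rewrite mxE sqrrD.
rewrite !big_split/= lerD2r lerD2l mulr2n.
by rewrite lerD ?cauchy_schwarz_rV.
Qed.

Lemma enormB x y : enorm (x - y) = enorm (y - x).
Proof. by rewrite -enormN opprB. Qed.

Lemma le_coord_enorm x i : `|x ord0 i| <= enorm x.
Proof.
rewrite -ler_sqr ?nnegrE ?enorm_ge0// real_normK ?num_real// sqr_enorm.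
by rewrite (bigD1 i)//= lerDl sumr_ge0// => j _; exact: sqr_ge0.
Qed.

Lemma enorm_le_sum x : enorm x <= \sum_i `|x ord0 i|.
Proof.
rewrite -ler_sqr ?nnegrE ?enorm_ge0 ?sumr_ge0// sqr_enorm expr2 mulr_suml.
apply: ler_sum => i _; rewrite -(real_normK (num_real _)) expr2.
by rewrite ler_wpM2l// (bigD1 i)//= lerDl sumr_ge0.
Qed.

Lemma enorm_le_max x (e : R) : (forall i, `|x ord0 i| <= e) ->
  enorm x <= d%:R * e.
Proof.
move=> xe; apply: le_trans (enorm_le_sum x) _.
apply: (@le_trans _ _ (\sum_(i < d) e)); first exact: ler_sum.
by rewrite sumr_const card_ord mulr_natl.
Qed.

Lemma set_dist_ge0 S x : 0 <= set_dist S x.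
Proof.
have [->|/set0P S0] := eqVneq S set0; first by rewrite /set_dist image_set0 inf0.
apply: lb_le_inf; first by case: S0 => u Su; exists (enorm (x - u)); exists u.
by move=> _ [u _ <-]; exact: enorm_ge0.
Qed.

Lemma set_dist_le S x u : S u -> set_dist S x <= enorm (x - u).
Proof.
move=> Su; apply: ge_inf; last by exists u.
by exists 0 => _ [v _ <-]; exact: enorm_ge0.
Qed.

Lemma set_dist_adherent S x (e : R) : S !=set0 -> 0 < e ->
  exists2 u, S u & enorm (x - u) < set_dist S x + e.
Proof.
move=> [u0 Su0] e0.
have hS : has_inf [set enorm (x - u) | u in S].
  by split; [exists (enorm (x - u0)); exists u0|
             exists 0 => _ [v _ <-]; exact: enorm_ge0].
by have [_ [u Su <-] ?] := inf_adherent e0 hS; exists u.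
Qed.

Lemma set_dist_lip S x y : S !=set0 ->
  set_dist S x <= set_dist S y + enorm (x - y).
Proof.
move=> S0; apply/ler_addgt0Pr => e e0.
have [u Su uy] := set_dist_adherent y S0 e0.
apply: le_trans (set_dist_le x Su) _.
rewrite (_ : x - u = (y - u) + (x - y)); last by rewrite [RHS]addrC subrKA.
by apply: le_trans (enormD _ _) _; lra.
Qed.

End euclidean_norm.

Section lipschitz_measurable.
Context (R : realType) (d : nat).

Let grid (m : nat) (z : {ffun 'I_d -> int}) : 'rV[R]_d :=
  \row_i ((z i)%:~R / m.+1%:R).

Let flr (m : nat) (x : 'rV[R]_d) : {ffun 'I_d -> int} :=
  [ffun i => Num.floor (x ord0 i * m.+1%:R)].

Let grid_flr m x : enorm (x - grid m (flr m x)) <= d%:R * m.+1%:R^-1.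
Proof.
apply: enorm_le_max => i; rewrite !mxE ffunE.
have m0 : 0 < m.+1%:R :> R by rewrite ltr0n.
rewrite -[X in `|X - _|](mulfK (lt0r_neq0 m0)) -mulrBl normrM.
rewrite [X in _ * X]gtr0_norm ?invr_gt0// ler_piMl ?invr_ge0// ler_norml.
have := floor_le (x ord0 i * m.+1%:R); have := floorD1_gt (x ord0 i * m.+1%:R).
by rewrite intrD/=; lra.
Qed.

(** The sigma-algebra is generated by the coordinates, so measurability cannot be
    read off from open sets. Rounding the argument down to the lattice of mesh
    1 / (m + 1) gives functions which take countably many values, each on a
    countable union of boxes, and which converge to g. *)
Lemma lipschitz_measurable (g : 'rV[R]_d -> R) :
  (forall x y, g x <= g y + enorm (x - y)) -> measurable_fun setT g.
Proof.
move=> glip.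
have mfloor m i k : measurable ((fun x : 'rV[R]_d =>
    Num.floor (x ord0 i * m.+1%:R)) @^-1` [set k]).
  rewrite (_ : _ @^-1` _ = (fun x : 'rV[R]_d => x ord0 i * m.+1%:R) @^-1`
      `[k%:~R, (k + 1)%:~R[%classic); last first.
    apply/seteqP; split => x/=; rewrite in_itv/=.
      by move=> <-; rewrite floor_le floorD1_gt.
    exact: floor_def.
  rewrite -[X in measurable X]setTI.
  have mc : measurable_fun setT (fun x : 'rV[R]_d => x ord0 i * m.+1%:R).
    apply: measurable_funM => //; exact: measurable_rV_coord.
  by apply: mc => //; exact: measurable_itv.
apply: (@measurable_fun_cvg _ _ _ _ (fun m x => g (grid m (flr m x)))) => //.
  move=> m _ Y mY; rewrite setTI.
  rewrite (_ : _ @^-1` _ = \bigcup_(z : {ffun 'I_d -> int})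
     (if g (grid m z) \in Y then [set x | flr m x = z] else set0)); last first.
    apply/seteqP; split => [x/= Yx|x [z _]].
      by exists (flr m x) => //; rewrite mem_set.
    by case: ifPn => // /set_mem Yz/= ->.
  apply: countable_bigcupT_measurable => // z; case: ifPn => // _.
  rewrite (_ : [set x | _] = \bigcap_(i in [set: 'I_d])
    ((fun x : 'rV[R]_d => Num.floor (x ord0 i * m.+1%:R)) @^-1` [set z i])).
    apply: fin_bigcap_measurable => // i _.
  by apply/seteqP; split => [x <- i _|x xz]/=; [rewrite ffunE|apply/ffunP => i;
    rewrite ffunE; exact: xz].
move=> x _; apply/cvgrPdist_le => e e0; near=> m.
have xm : enorm (x - grid m (flr m x)) <= e.
  apply: le_trans (grid_flr m x) _; rewrite ler_pdivrMr ?ltr0n// mulrC -ler_pdivrMr//.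
  apply: ltW; apply: lt_le_trans (truncnS_gt _) _; rewrite ler_nat ltnS.
  by near: m; exists (Num.truncn (d%:R / e)).
rewrite ler_norml; have := glip x (grid m (flr m x)).
by have := glip (grid m (flr m x)) x; rewrite enormB; lra.
Unshelve. all: by end_near. Qed.
End lipschitz_measurable.

Lemma measurable_set_dist (R : realType) d (S : set 'rV[R]_d) : S !=set0 ->
  measurable_fun setT (set_dist S).
Proof. by move=> S0; apply: lipschitz_measurable => x y; exact: set_dist_lip. Qed.

Lemma std_normal_densityE (R : realType) d (z : 'rV[R]_d) :
  std_normal_density z = \prod_i normal_pdf 0 1 (z ord0 i).
Proof.
under eq_bigr do rewrite normal_pdfE ?oner_eq0//.
rewrite big_split/= prodr_const card_ord; congr (_ * _).
  have a0 : 0 <= 2 * pi :> R by rewrite mulr_ge0 ?pi_ge0.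
  rewrite /normal_peak expr1n mul1r -(mulr_natl pi) -powR12_sqrt// -powRN.
  by rewrite -powR_mulrn ?powR_ge0// -powRrM; congr (_ `^ _); lra.
rewrite /normal_fun -expR_sum sqr_enorm; congr expR.
rewrite -sumrN mulr_suml; apply: eq_bigr => i _.
by rewrite subr0 expr1n.
Qed.

Lemma std_normal_density_gt0 (R : realType) d (z : 'rV[R]_d) :
  0 < std_normal_density z.
Proof. by rewrite mulr_gt0 ?expR_gt0// powR_gt0// mulr_gt0// pi_gt0. Qed.

Definition normal_const (R : realType) d : R := (2 * pi) `^ (- (d%:R / 2)).

Lemma normal_const_gt0 (R : realType) d : 0 < normal_const R d.
Proof. by rewrite powR_gt0// mulr_gt0// pi_gt0. Qed.

Lemma normal_const_le1 (R : realType) d : normal_const R d <= 1.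
Proof.
rewrite /normal_const powRN invf_le1 ?powR_gt0 ?mulr_gt0 ?pi_gt0//.
have p1 : 1 <= 2 * pi :> R by have := pi_ge2 R; lra.
by rewrite -[leLHS](powRr0 (2 * pi)) ler_powR// divr_ge0.
Qed.

Lemma std_normal_density_prod (R : realType) d (z : 'rV[R]_d) :
  std_normal_density z =
  normal_const R d * \prod_i expR (- (z ord0 i) ^+ 2 / 2).
Proof.
congr (_ * _); rewrite -expR_sum sqr_enorm; congr expR.
by rewrite -sumrN mulr_suml.
Qed.

Lemma std_normal_density_le1 (R : realType) d (z : 'rV[R]_d) :
  std_normal_density z <= 1.
Proof.
rewrite mulr_ile1 ?expR_ge0 ?powR_ge0 ?normal_const_le1//.
rewrite -expR0 ler_expR mulNr oppr_le0 divr_ge0//.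
exact: sqr_ge0.
Qed.

Lemma measurable_std_normal (R : realType) d :
  measurable_fun setT
    (fun z : 'rV[R]_d * 'rV[R]_d => std_normal_density (z.1 - z.2)).
Proof.
under eq_fun do rewrite std_normal_densityE.
apply: measurable_prod => i _.
apply: measurableT_comp; first exact: measurable_normal_pdf.
under eq_fun do rewrite !mxE.
by apply: measurable_funB; apply: measurableT_comp (measurable_rV_coord i) _.
Qed.

(** * Gaussian mixture densities *)

Lemma integral_lebesgue_rVS (R : realType) d (f : 'rV[R]_d.+1 -> \bar R) :
  measurable_fun setT f -> (forall x, 0 <= f x)%E ->
  (\int[@lebesgue_rV R d.+1]_x f x =
   \int[@lebesgue_measure R]_t \int[@lebesgue_rV R d]_x f (rV_cons (t, x)))%E.
Proof.
move=> mf f0.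
transitivity (\int[pushforward (@lebesgue_measure R \x @lebesgue_rV R d)%E
  (@rV_cons R d)]_x f x)%E; first by [].
rewrite ge0_integral_pushforward//; last exact: measurable_rV_cons.
rewrite preimage_setT fubini_tonelli1//; last by move=> x; exact: f0.
by apply: measurableT_comp => //; exact: measurable_rV_cons.
Qed.

Lemma integral_lebesgue_rV_prod (R : realType) d (g : 'I_d -> R -> R) :
  (forall i, measurable_fun setT (g i)) -> (forall i t, 0 <= g i t) ->
  (\int[@lebesgue_rV R d]_x (\prod_i g i (x ord0 i))%:E =
   \prod_i \int[@lebesgue_measure R]_t (g i t)%:E)%E.
Proof.
elim: d g => [|d IH] g mg g0.
  transitivity (\int[@dirac _ 'rV[R]_0 0%R R]_x (\prod_i g i (x ord0 i))%:E)%E; first by [].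
  rewrite integral_dirac//; first by rewrite !big_ord0 diracT mul1e.
  by apply/measurable_EFinP; under eq_fun do rewrite big_ord0; exact: measurable_cst.
rewrite integral_lebesgue_rVS; last 2 first.
- apply/measurable_EFinP; apply: measurable_prod => i _.
  by apply: measurableT_comp => //; exact: measurable_rV_coord.
- by move=> x; rewrite lee_fin prodr_ge0.
rewrite big_ord_recl -IH//.
rewrite -ge0_integralZr//; last 3 first.
- by have /measurable_EFinP := mg ord0.
- by move=> t _; rewrite lee_fin.
- by apply: integral_ge0 => x _; rewrite lee_fin prodr_ge0.
apply: eq_integral => t _; rewrite -ge0_integralZl//.
- apply: eq_integral => x _; rewrite -EFinM big_ord_recl rV_cons0/=.
  by congr (_ * _)%:E; apply: eq_bigr => i _; rewrite rV_consS.
- apply/measurable_EFinP; apply: measurable_prod => i _.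
  by apply: measurableT_comp => //; exact: measurable_rV_coord.
- by move=> x _; rewrite lee_fin prodr_ge0.
- by rewrite lee_fin.
Qed.

Lemma normal_pdf_sub (R : realType) (s m x : R) : s != 0 ->
  normal_pdf 0 s (x - m) = normal_pdf m s x.
Proof. by move=> s0; rewrite !normal_pdfE// [in RHS]normal_fun_center. Qed.

Lemma integral_std_normal (R : realType) d (m : 'rV[R]_d) :
  (\int[@lebesgue_rV R d]_x (std_normal_density (x - m))%:E = 1)%E.
Proof.
under eq_integral do rewrite std_normal_densityE.
rewrite (eq_integral (fun x : 'rV[R]_d => (\prod_i normal_pdf (m ord0 i) 1 (x ord0 i))%:E)); last first.
  move=> x _; congr EFin; apply: eq_bigr => i _.
  by rewrite !mxE normal_pdf_sub ?oner_eq0.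
rewrite (integral_lebesgue_rV_prod (g := fun i => normal_pdf (m ord0 i) 1)).
- by rewrite big1// => i _; exact: integral_normal_pdf.
- by move=> i; exact: measurable_normal_pdf.
- by move=> i t; exact: normal_pdf_ge0.
Qed.

Section mixture_density.
Context (R : realType) (d : nat).
Implicit Types (G : probability 'rV[R]_d R).
Local Notation mu := (@lebesgue_rV R d).

Lemma measurable_std_normal_l (m : 'rV[R]_d) :
  measurable_fun setT (fun x : 'rV[R]_d => std_normal_density (x - m)).
Proof.
exact: (measurableT_comp (@measurable_std_normal R d) (measurable_pair2 m)).
Qed.

Lemma measurable_std_normal_r (x : 'rV[R]_d) :
  measurable_fun setT (fun m : 'rV[R]_d => std_normal_density (x - m)).
Proof.
exact: (measurableT_comp (@measurable_std_normal R d) (measurable_pair1 x)).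
Qed.

Lemma integral_cst_prob disp (T : measurableType disp) (P : probability T R)
  (c : \bar R) : (\int[P]_m c = c)%E.
Proof.
by rewrite (integral_cst P measurableT c) [X in (_ * X)%E]probability_setT mule1.
Qed.

Lemma bounded_integrable (G : probability 'rV[R]_d R) (f : 'rV[R]_d -> R) (B : R) :
  measurable_fun setT f -> (forall x, `|f x| <= B) ->
  G.-integrable setT (EFin \o f).
Proof.
move=> mf fB; apply: (@le_integrable _ _ _ _ _ _ _ (EFin \o cst B)) => //.
- exact/measurable_EFinP.
- by move=> x _ /=; rewrite lee_fin (le_trans (fB x))// ler_norm.
- exact: finite_measure_integrable_cst.
Qed.

Lemma integrable_std_normal G x :
  G.-integrable setT (fun m => (std_normal_density (x - m))%:E).
Proof.
apply: (@bounded_integrable _ _ 1); first exact: measurable_std_normal_r.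
by move=> m; rewrite ger0_norm ?std_normal_density_le1// ltW// std_normal_density_gt0.
Qed.

Lemma mixture_densityE G x :
  ((mixture_density G x)%:E = \int[G]_m (std_normal_density (x - m))%:E)%E.
Proof.
rewrite /mixture_density /Rintegral fineK//.
by apply: integrable_fin_num => //; exact: integrable_std_normal.
Qed.

Lemma mixture_density_le_const G x : mixture_density G x <= normal_const R d.
Proof.
rewrite -lee_fin mixture_densityE.
apply: (@le_trans _ _ (\int[G]_m (normal_const R d)%:E)%E); last first.
  by rewrite integral_cst_prob.
apply: ge0_le_integral => //.
- by move=> m _; rewrite lee_fin ltW// std_normal_density_gt0.
- by apply/measurable_EFinP; exact: measurable_std_normal_r.
- move=> m _; rewrite lee_fin std_normal_density_prod.
  rewrite ler_piMr ?(ltW (normal_const_gt0 _ _))//.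
  apply: (@le_trans _ _ (\prod_(i < d) 1)); last by rewrite big1.
  apply: ler_prod => i _; rewrite expR_ge0/= -expR0 ler_expR mulNr oppr_le0.
  by rewrite divr_ge0// sqr_ge0.
Qed.

(** If the integral of the positive kernel vanished, the kernel would be zero
    almost everywhere, and the whole space would be negligible. *)
Lemma mixture_density_gt0 G x : 0 < mixture_density G x.
Proof.
rewrite lt_neqAle Rintegral_ge0 ?andbT; last first.
  by move=> m _; rewrite ltW// std_normal_density_gt0.
apply/negP => /eqP H.
have := mixture_densityE G x; rewrite -H => /esym.
have : (\int[G]_m `|(std_normal_density (x - m))%:E| = 0)%E ->
   ae_eq G setT (fun m => (std_normal_density (x - m))%:E) (cst 0%E).
  move=> ?; apply/ae_eq_integral_abs => //.
  by apply/measurable_EFinP; exact: measurable_std_normal_r.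
move=> h1 h2.
have /h1 : (\int[G]_m `|(std_normal_density (x - m))%:E| = 0)%E.
  rewrite -[RHS]h2; apply: eq_integral => m _.
  by rewrite gee0_abs// lee_fin ltW// std_normal_density_gt0.
case=> N [mN N0 sN].
have : [set: 'rV[R]_d] `<=` N.
  move=> m _; apply: sN => /= /(_ I) [] /eqP.
  by rewrite gt_eqF// std_normal_density_gt0.
move=> /(le_measure G); rewrite !inE => /(_ measurableT mN).
by rewrite [X in (_ <= X)%E]N0 [X in (X <= _)%E]probability_setT lee_fin ler10.
Qed.

Lemma mixture_density_ge0 G x : 0 <= mixture_density G x.
Proof. exact/ltW/mixture_density_gt0. Qed.

Lemma mixture_density_le1 G x : mixture_density G x <= 1.
Proof. exact: le_trans (mixture_density_le_const _ _) (normal_const_le1 _ _). Qed.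

Lemma measurable_mixture_density G : measurable_fun setT (mixture_density G).
Proof.
apply/measurable_EFinP.
rewrite (_ : EFin \o _ = fubini_F G
    (fun z : 'rV[R]_d * 'rV[R]_d => (std_normal_density (z.1 - z.2))%:E)).
  apply: measurable_fun_fubini_tonelli_F.
    by apply/measurable_EFinP; exact: measurable_std_normal.
  by move=> z; rewrite lee_fin ltW// std_normal_density_gt0.
by apply/funext => x; rewrite /= mixture_densityE.
Qed.

(** This is the way in which integrals against a mixture are computed below:
    conditionally on the centre m, the law is a Gaussian centred at m. *)
Lemma integral_mul_mixture G (q : 'rV[R]_d -> \bar R) :
  measurable_fun setT q -> (forall x, 0 <= q x)%E ->
  (\int[mu]_x (q x * (mixture_density G x)%:E) =
   \int[G]_m \int[mu]_x (q x * (std_normal_density (x - m))%:E))%E.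
Proof.
move=> mq q0.
transitivity (\int[mu]_x \int[G]_m (q x * (std_normal_density (x - m))%:E))%E.
  apply: eq_integral => x _; rewrite mixture_densityE -ge0_integralZl//.
    by apply/measurable_EFinP; exact: measurable_std_normal_r.
  by move=> m _; rewrite lee_fin ltW// std_normal_density_gt0.
apply: (fubini_tonelli (fun z : 'rV[R]_d * 'rV[R]_d => q z.1 * (std_normal_density (z.1 - z.2))%:E)%E).
  apply: emeasurable_funM; first exact: measurableT_comp.
  by apply/measurable_EFinP; exact: measurable_std_normal.
by move=> z; rewrite mule_ge0// lee_fin ltW// std_normal_density_gt0.
Qed.

Lemma integral_mixture_density G : (\int[mu]_x (mixture_density G x)%:E = 1)%E.
Proof.
transitivity (\int[mu]_x (cst 1 x * (mixture_density G x)%:E))%E.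
  by apply: eq_integral => x _; rewrite mul1e.
rewrite integral_mul_mixture//.
rewrite (eq_integral (cst 1%E)); first by rewrite integral_cst_prob.
move=> m _; under eq_integral do rewrite mul1e; exact: integral_std_normal.
Qed.

End mixture_density.

(** * Independence and a Chernoff bound for products *)

Section weighted_integral_ext.
Context d1 d2 d3 (T1 : measurableType d1) (T2 : measurableType d2)
  (T : measurableType d3) (R : realType).
Variables (m1 : {measure set T1 -> \bar R}) (m2 : {measure set T2 -> \bar R}).
Variables (g1 : T1 -> R) (g2 : T2 -> R) (X1 : T1 -> T) (X2 : T2 -> T).
Hypotheses (mg1 : measurable_fun setT g1) (mg2 : measurable_fun setT g2).
Hypotheses (mX1 : measurable_fun setT X1) (mX2 : measurable_fun setT X2).
Hypotheses (g10 : forall x, 0 <= g1 x) (g20 : forall x, 0 <= g2 x).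
Hypothesis H : forall A, measurable A ->
  (\int[m1]_x (\1_A (X1 x) * g1 x)%:E = \int[m2]_x (\1_A (X2 x) * g2 x)%:E)%E.

Import HBNNSimple.

Let sumE d' (S : measurableType d') (m : {measure set S -> \bar R}) (g : S -> R)
    (Y : S -> T) (f : {nnsfun T >-> R}) :
  measurable_fun setT g -> measurable_fun setT Y -> (forall x, 0 <= g x) ->
  (\int[m]_x (f (Y x) * g x)%:E =
   \sum_(r \in range f) (r%:E * \int[m]_x (\1_(f @^-1` [set r]) (Y x) * g x)%:E))%E.
Proof.
move=> mg mY g0.
have mi r : measurable_fun setT (fun x => \1_(f @^-1` [set r]) (Y x) * g x).
  apply: measurable_funM => //; apply: measurableT_comp mY.
  exact: measurable_indic.
have i0 r x : (0 <= (\1_(f @^-1` [set r]) (Y x) * g x)%:E)%E.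
  by rewrite lee_fin mulr_ge0.
transitivity (\int[m]_x \sum_(r \in range f)
    (r * (\1_(f @^-1` [set r]) (Y x) * g x))%:E)%E.
  apply: eq_integral => x _; rewrite fsumEFin//; congr EFin.
  by rewrite fimfunE mulr_fsuml; apply: eq_fsbigr => r _; rewrite mulrA.
rewrite ge0_integral_fsum//; last 2 first.
- by move=> r; apply/measurable_EFinP; apply: measurable_funM.
- move=> r x _; rewrite mulrA EFinM mule_ge0 ?lee_fin//.
  by have := nnfun_muleindic_ge0 f r (Y x); rewrite -EFinM lee_fin.
apply: eq_fsbigr => r _; under eq_integral do rewrite EFinM.
have [r0|r0] := leP 0 r.
  rewrite ge0_integralZl//; exact/measurable_EFinP.
have z x : (\1_(f @^-1` [set r]) (Y x) * g x)%:E = 0%:E.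
  rewrite indicE memNset ?mul0r//= => fr.
  by move: r0; rewrite -fr ltNge fun_ge0.
by under eq_integral do rewrite z mule0; under [in RHS]eq_integral do rewrite z; rewrite integral0 mule0.
Qed.

Let limE d' (S : measurableType d') (m : {measure set S -> \bar R}) (g : S -> R)
    (Y : S -> T) (q : T -> R) (mq : measurable_fun setT (EFin \o q)) :
  measurable_fun setT g -> measurable_fun setT Y -> (forall x, 0 <= g x) ->
  (forall x, 0 <= q x) ->
  (\int[m]_x (q (Y x) * g x)%:E =
   limn (fun n => \int[m]_x (nnsfun_approx measurableT mq n (Y x) * g x)%:E))%E.
Proof.
move=> mg mY g0 q0; rewrite -monotone_convergence//.
- apply: eq_integral => x _; apply/esym/cvg_lim => //.
  under eq_fun do rewrite EFinM.
  rewrite EFinM; apply: cvgeZr => //.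
  by apply: cvg_nnsfun_approx => // t _; rewrite lee_fin.
- move=> n; apply/measurable_EFinP; apply: measurable_funM => //.
  exact: measurableT_comp.
- by move=> n x _; rewrite lee_fin mulr_ge0.
- move=> x _ a b ab; rewrite lee_fin ler_wpM2r//.
  exact/lefP/nd_nnsfun_approx.
Qed.

(** Both sides are integrals of q against a measure on T, and the two measures
    agree on sets, hence on simple functions, and on q by monotone convergence.
    The weights g1 and g2 carry the other coordinates when independence is
    used one coordinate at a time. *)
Lemma weighted_integral_ext (q : T -> R) : measurable_fun setT q ->
  (forall x, 0 <= q x) ->
  (\int[m1]_x (q (X1 x) * g1 x)%:E = \int[m2]_x (q (X2 x) * g2 x)%:E)%E.
Proof.
move=> /measurable_EFinP mq q0.
rewrite (limE m1 mq)// (limE m2 mq)//; congr (limn _); apply/funext => n.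
rewrite !sumE//; apply: eq_fsbigr => r _; congr (_ * _)%E; exact: H.
Qed.
End weighted_integral_ext.

(* The mean of an empty family is the zero measure, hence the successor. *)
Section mean_measureS.
Context d (T : measurableType d) (R : realType) (n : nat).
Variable G : 'I_n.+1 -> probability T R.
HB.instance Definition _ := Measure_isProbability.Build _ _ _
  (mean_measure G) (mean_measure_setT G (ltn0Sn n)).
End mean_measureS.

Section mean_measure_prob.
Context d (T : measurableType d) (R : realType) (n : nat).
Variable G : 'I_n -> probability T R.
Hypothesis n0 : (0 < n)%N.

Lemma mean_measure_probability :
  exists Q : probability T R, forall A, Q A = mean_measure G A.
Proof. by case: n n0 G => // k _ G'; exists (mean_measure G'). Qed.

Lemma integral_mean_measure (f : T -> \bar R) : measurable_fun setT f ->
  (forall x, 0 <= f x)%E ->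
  (\int[mean_measure G]_x f x = (n%:R^-1)%:E * \sum_(i < n) \int[G i]_x f x)%E.
Proof.
move=> mf f0.
pose m k : {measure set T -> \bar R} :=
  if insub k is Some i then G i else mzero.
have r0 : (0 <= n%:R^-1 :> R) by rewrite invr_ge0.
transitivity (\int[mscale (NngNum r0) (msum m n)]_x f x)%E.
  congr (integral _ _ _); apply/funext => A.
  rewrite /mean_measure /mscale /msum/=; congr (_ * _)%E.
  by apply: eq_bigr => i _; rewrite /m valK.
rewrite ge0_integral_mscale// ge0_integral_measure_sum//; congr (_ * _)%E.
by apply: eq_bigr => i _; rewrite /m valK.
Qed.
End mean_measure_prob.

Lemma eq_mixture_density (R : realType) d (G1 G2 : {measure set 'rV[R]_d -> \bar R}) :
  (forall A, G1 A = G2 A) -> mixture_density G1 = mixture_density G2.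
Proof.
move=> G12; apply/funext => x; rewrite /mixture_density /Rintegral; congr fine.
by apply: eq_measure_integral => A _ _; exact: G12.
Qed.

(** The mixture density is linear in the mixing measure: this is what makes the
    density of the mean the average of the densities of the observations. *)
Lemma mixture_density_mean (R : realType) d n (G : 'I_n -> probability 'rV[R]_d R) x :
  (0 < n)%N ->
  n%:R * mixture_density (mean_measure G) x = \sum_(i < n) mixture_density (G i) x.
Proof.
move=> n0; have [Q QG] := mean_measure_probability G n0.
rewrite -(eq_mixture_density QG).
apply: EFin_inj; rewrite EFinM mixture_densityE.
rewrite (eq_measure_integral (mean_measure G)); last by move=> A _ _; exact: QG.
rewrite integral_mean_measure//.
- rewrite muleA -EFinM divff ?pnatr_eq0 -?lt0n// mul1e -sumEFin.
  by apply: eq_bigr => i _; rewrite mixture_densityE.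
- by apply/measurable_EFinP; exact: measurable_std_normal_r.
- by move=> m; rewrite lee_fin ltW// std_normal_density_gt0.
Qed.

Section independence.
Context (R : realType) (d : nat) (disp : measure_display)
  (Omega : measurableType disp) (P : probability Omega R) (n : nat).
Variable X : 'I_n -> {RV P >-> 'rV[R]_d}.

Lemma expectation_density (i : 'I_n) (f q : 'rV[R]_d -> R) :
  has_density (X i) f -> measurable_fun setT f -> (forall x, 0 <= f x) ->
  measurable_fun setT q -> (forall x, 0 <= q x) ->
  (\int[P]_w (q (X i w))%:E = \int[@lebesgue_rV R d]_x (q x * f x)%:E)%E.
Proof.
move=> Xf mf f0 mq q0.
transitivity (\int[P]_w (q (X i w) * cst 1 w)%:E)%E.
  by apply: eq_integral => w _; rewrite mulr1.
apply: (weighted_integral_ext (X2 := id)) => // A mA.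
transitivity (distribution P (X i) A).
  rewrite /distribution /pushforward -[in RHS](setIT (X i @^-1` A)) -integral_indic//.
    by apply: eq_integral => w _; rewrite /= mulr1.
  by rewrite -[X in measurable X]setTI; exact: measurable_funPT.
rewrite Xf// [LHS]integral_mkcond; apply: eq_integral => x _ /=.
by rewrite patchE indicE; case: ifPn; rewrite ?mul1r ?mul0r.
Qed.

Hypothesis indepX : mutually_independent X.

(** Independence is the product rule for indicators. Induction on k replaces the
    indicators of the first k coordinates by the functions q i, by approximating
    one q by simple functions while the other factors stay fixed. *)
Lemma expectation_prod (q : 'I_n -> 'rV[R]_d -> R) (c : 'I_n -> R) :
  (forall i, measurable_fun setT (q i)) -> (forall i x, 0 <= q i x) ->
  (forall i, \int[P]_w (q i (X i w))%:E = (c i)%:E)%E ->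
  (\int[P]_w (\prod_i q i (X i w))%:E = (\prod_i c i)%:E)%E.
Proof.
move=> mq q0 qc.
have mXA i A : measurable A -> measurable (X i @^-1` A).
  by move=> mA; rewrite -[X in measurable X]setTI; exact: measurable_funPT.
(* In stage k, the coordinates below k carry q and the others an indicator;
   e k A i is the corresponding expectation. *)
pose h k (A : 'I_n -> set 'rV[R]_d) (i : 'I_n) x : R :=
  if (i < k)%N then q i x else \1_(A i) x.
pose e k (A : 'I_n -> set 'rV[R]_d) (i : 'I_n) : R :=
  if (i < k)%N then c i else fine (P (X i @^-1` A i)).
have mh k A i : (forall i, measurable (A i)) ->
    measurable_fun setT (fun w => h k A i (X i w)).
  move=> mA; rewrite /h; case: (i < k)%N; apply: measurableT_comp => //.
have h0 k A i x : 0 <= h k A i x by rewrite /h; case: (i < k)%N.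
have c0 i : 0 <= c i.
  by rewrite -lee_fin -qc; apply: integral_ge0 => w _; rewrite lee_fin.
have e0 k A i : 0 <= e k A i.
  by rewrite /e; case: ifPn => // _; rewrite fine_ge0.
suff main k : forall A, (forall i, measurable (A i)) ->
    (\int[P]_w (\prod_i h k A i (X i w))%:E = (\prod_i e k A i)%:E)%E.
  have := main n (fun=> set0) (fun=> measurable0).
  under eq_integral do under eq_bigr do rewrite /h ltn_ord.
  by move=> ->; congr EFin; apply: eq_bigr => i _; rewrite /e ltn_ord.
elim: k => [|k IH] A mA.
  transitivity (\int[P]_w (\1_(\bigcap_(i in [set` [set: 'I_n]%SET]) (X i @^-1` A i)) w)%:E)%E.
    apply: eq_integral => w _; congr EFin; rewrite /h/= indicE.
    case: (boolP (w \in _)) => [/set_mem wA|].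
      by rewrite big1// => i _; rewrite indicE mem_set//; apply: wA => /=; rewrite inE.
    rewrite notin_setE => wA; apply/eqP; rewrite prodf_seq_eq0.
    apply/hasP; apply: contra_notP wA => wA i _ /=; apply: contra_notP wA => wA.
    exists i; first exact: mem_index_enum.
    by rewrite /= indicE memNset// eqxx.
  rewrite integral_indic//; last first.
    by apply: fin_bigcap_measurable => //= i _; exact: mXA.
  rewrite setIT; apply: etrans (indepX [set: 'I_n]%SET mA) _; rewrite -prodEFin; apply: eq_big => i; first by rewrite inE.
  by move=> _; rewrite /e/= fineK// fin_num_measure//; exact: mXA.
have [kn|nk] := ltnP k n; last first.
  have E (i : 'I_n) : (i < k.+1)%N = (i < k)%N.
    by have ik := leq_trans (ltn_ord i) nk; rewrite ik ltnW.
  have -> : (\prod_i e k.+1 A i) = \prod_i e k A i.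
    by apply: eq_bigr => i _; rewrite /e E.
  rewrite -IH//; apply: eq_integral => w _; congr EFin.
  by apply: eq_bigr => i _; rewrite /h E.
pose j := Ordinal kn.
pose Y w := \prod_(i < n | i != j) h k A i (X i w).
pose C := \prod_(i < n | i != j) e k A i.
have Ek (i : 'I_n) : i != j -> (i < k.+1)%N = (i < k)%N.
  by move=> ij; rewrite ltnS leq_eqVlt -[k]/(val j) val_eqE (negbTE ij).
transitivity (\int[P]_w (q j (X j w) * Y w)%:E)%E.
  apply: eq_integral => w _; congr EFin; rewrite (bigD1 j)//= /h ltnS leqnn.
  by congr (_ * _); apply: eq_bigr => i ij; rewrite Ek.
rewrite (weighted_integral_ext (X2 := X j) (g2 := cst C) (m2 := P))//.
- under eq_integral do rewrite /= EFinM.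
  rewrite ge0_integralZr//; last 3 first.
  + by apply/measurable_EFinP; apply: measurableT_comp.
  + by move=> w _; rewrite lee_fin.
  + by rewrite lee_fin prodr_ge0.
  rewrite qc -EFinM (bigD1 j)//= {1}/e ltnS leqnn; congr (_ * _)%:E.
  by apply: eq_bigr => i ij; rewrite /e Ek.
- by rewrite /Y; under eq_fun do rewrite big_mkcond; apply: measurable_prod => i _;
    case: (i != j) => //; exact: mh.
- by move=> w; rewrite prodr_ge0.
- by move=> w; rewrite prodr_ge0.
move=> B mB.
pose A' i := if i == j then B else A i.
have mA' i : measurable (A' i) by rewrite /A'; case: ifPn.
transitivity (\int[P]_w (\prod_i h k A' i (X i w))%:E)%E.
  apply: eq_integral => w _; congr EFin; rewrite [RHS](bigD1 j)//= {1}/h ltnn.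
  rewrite {1}/A' eqxx; congr (_ * _); apply: eq_bigr => i ij.
  by rewrite /h /A' (negbTE ij).
rewrite IH//; under [RHS]eq_integral do rewrite /= EFinM.
rewrite ge0_integralZr//; last 2 first.
+ by apply/measurable_EFinP; apply: measurableT_comp.
+ by rewrite lee_fin prodr_ge0.
rewrite (bigD1 j)//= {1}/e ltnn {1}/A' eqxx EFinM; congr (_ * _)%E.
  rewrite fineK; last by rewrite fin_num_measure//; exact: mXA.
  by rewrite -[in LHS](setIT (X j @^-1` B)) -integral_indic//; exact: mXA.
by congr EFin; apply: eq_bigr => i ij; rewrite /e /A' (negbTE ij).
Qed.

(** Markov's inequality for the product, whose expectation is the product of the
    integrals of g * f i. The inequality x <= e^(x - 1) turns this product into the
    exponential of a sum, in which only the average f0 of the densities f i is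
    left: identical distribution is replaced by this averaging. *)
Lemma chernoff_product (f : 'I_n -> 'rV[R]_d -> R) (f0 g : 'rV[R]_d -> R) (a b : R) :
  (forall i, has_density (X i) (f i)) ->
  (forall i, measurable_fun setT (f i)) -> (forall i x, 0 <= f i x) ->
  (forall x, \sum_(i < n) f i x = n%:R * f0 x) -> (forall x, 0 <= f0 x) ->
  measurable_fun setT f0 ->
  measurable_fun setT g -> (forall x, 0 <= g x) ->
  (\int[@lebesgue_rV R d]_x (g x * f0 x)%:E <= a%:E)%E ->
  (P [set w | (expR b <= \prod_(i < n) g (X i w))%R] <=
   (expR (- b + n%:R * (a - 1)))%:E)%E.
Proof.
move=> Xf mf fge0 sumf f00 mf0 mg g0 ga.
pose I i := (\int[@lebesgue_rV R d]_x (g x * f i x)%:E)%E.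
have mgf i : measurable_fun setT (fun x => (g x * f i x)%:E).
  by apply/measurable_EFinP; exact: measurable_funM.
have I0 i : (0 <= I i)%E.
  by apply: integral_ge0 => x _; rewrite lee_fin mulr_ge0.
have sumI : (\sum_i I i <= (n%:R * a)%:E)%E.
  rewrite -ge0_integral_sum//; last by move=> i x _; rewrite lee_fin mulr_ge0.
  rewrite (eq_integral (fun x => n%:R%:E * (g x * f0 x)%:E)%E); last first.
    by move=> x _; rewrite sumEFin -mulr_sumr sumf -EFinM; congr EFin; lra.
  rewrite ge0_integralZl// ?EFinM ?lee_wpmul2l//.
  - by apply/measurable_EFinP; exact: measurable_funM.
  - by move=> x _; rewrite lee_fin mulr_ge0.
have Ifin i : I i \is a fin_num.
  rewrite ge0_fin_numE//; apply: le_lt_trans (ltry (n%:R * a)).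
  apply: le_trans sumI; rewrite (bigD1 i)//= leeDl// sume_ge0//.
have sumIR : \sum_i fine (I i) <= n%:R * a.
  rewrite -lee_fin -sumEFin; apply: le_trans sumI.
  by apply: lee_sum => i _; rewrite fineK.
have EP := @expectation_prod (fun=> g) (fun i => fine (I i)) (fun=> mg) (fun=> g0).
have {}EP : (\int[P]_w (\prod_i g (X i w))%:E = (\prod_i fine (I i))%:E)%E.
  by apply: EP => i; rewrite fineK//; exact: expectation_density.
have mZ : measurable_fun setT (fun w => \prod_(i < n) g (X i w)).
  by apply: measurable_prod => i _; exact: measurableT_comp.
set A := [set w | _]; have mA : measurable A.
  by rewrite -[X in measurable X]setTI; exact: (measurable_fun_le (f := cst (expR b))).
have : ((expR b)%:E * P A <= (\prod_i fine (I i))%:E)%E.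
  rewrite -EP -[in leLHS](setIT A) -integral_indic//.
  rewrite -ge0_integralZl ?lee_fin ?expR_ge0//; last exact/measurable_EFinP.
  apply: ge0_le_integral => //.
  - by apply/measurable_EFinP; exact: measurable_funM.
  - exact/measurable_EFinP.
  - move=> w _; rewrite -EFinM lee_fin indicE.
    case: (boolP (w \in A)) => [/set_mem wA|_]; first by rewrite mulr1.
    by rewrite mulr0 prodr_ge0.
rewrite -[P A]fineK ?fin_num_measure// -EFinM !lee_fin => H.
rewrite expRD expRN -ler_pdivrMl ?invr_gt0 ?expR_gt0// invrK.
apply: le_trans H _.
apply: (@le_trans _ _ (\prod_i expR (fine (I i) - 1))).
  apply: ler_prod => i _; rewrite fine_ge0//=.
  by have := expR_ge1Dx (fine (I i) - 1); rewrite addrC subrK.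
rewrite -expR_sum ler_expR sumrB sumr_const card_ord; lra.
Qed.
End independence.

(** * Covering a compact set and its enlargements *)

Lemma measure_le_sum d (T : measurableType d) (R : realType)
    (mu : {measure set T -> \bar R}) (I : finType) (A : set T) (F : I -> set T) :
  measurable A -> (forall i, measurable (F i)) ->
  (forall x, A x -> exists i, F i x) -> (mu A <= \sum_i mu (F i))%E.
Proof.
move=> mA mF AF; rewrite fsbig_seq ?index_enum_uniq//; apply: content_sub_fsum => //.
by move=> x /AF[i Fx]; exists i => //=; rewrite mem_index_enum.
Qed.

Section cells.
Context (R : realType) (d : nat).
Implicit Types (S : set 'rV[R]_d).

Lemma compact_coord_bounded S : compact S ->
  exists B : nat, forall x, S x -> forall i, `|x ord0 i| <= B%:R.
Proof.
case: d S => [|d'] S.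
  by exists 0%N => x _ [].
move=> /compact_bounded[B [Br SB]].
exists (Num.truncn `|B|).+1 => x Sx i.
have : `|x| <= (Num.truncn `|B|).+1%:R.
  by apply: SB => //; apply: le_lt_trans (ler_norm B) _; exact: truncnS_gt.
by apply: le_trans; rewrite [leRHS]/Num.norm/= mx_normrE; apply/bigmax_geP; right; exists (ord0, i).
Qed.

(** The side 1 / d makes the Euclidean diameter of a cell at most 1. *)
Definition cell (B : nat) (K : nat) (z : {ffun 'I_d -> 'I_K}) : set 'rV[R]_d :=
  [set x | forall i, x ord0 i \in
    `[(z i)%:R / d%:R - B%:R, (z i).+1%:R / d%:R - B%:R[].

Lemma measurable_box (A : 'I_d -> set R) : (forall i, measurable (A i)) ->
  measurable [set x : 'rV[R]_d | forall i, A i (x ord0 i)].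
Proof.
move=> mA.
rewrite (_ : [set _ | _] = \bigcap_(i in [set: 'I_d])
    ((fun x : 'rV[R]_d => x ord0 i) @^-1` A i)).
  apply: fin_bigcap_measurable => // i _.
  by rewrite -[X in measurable X]setTI; exact: measurable_rV_coord.
by apply/seteqP; split => [x/= Ax i _|x/= Ax i]; exact: Ax.
Qed.

Hypothesis d0 : (0 < d)%N.
Let d0R : 0 < d%:R :> R. Proof. by rewrite ltr0n. Qed.

Lemma measurable_cell B K (z : {ffun 'I_d -> 'I_K}) : measurable (cell B z).
Proof.
exact: (measurable_box (fun i => measurable_itv
  `[(z i)%:R / d%:R - B%:R, (z i).+1%:R / d%:R - B%:R[)).
Qed.

Lemma cell_volume B K (z : {ffun 'I_d -> 'I_K}) :
  (@lebesgue_rV R d (cell B z) = (d%:R ^- d)%:E)%E.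
Proof.
rewrite (lebesgue_rV_box (A := fun i => [set` `[(z i)%:R / d%:R - B%:R,
  (z i).+1%:R / d%:R - B%:R[%R]))//.
rewrite (eq_bigr (fun=> (d%:R^-1)%:E)).
  by rewrite prodEFin prodr_const card_ord exprVn.
move=> i _; rewrite lebesgue_measure_itv/= lte_fin ltrD2r ltr_pM2r ?invr_gt0//.
rewrite ltr_nat ltnSn -EFinB; congr EFin.
by rewrite -[(z i).+1]addn1 natrD; lra.
Qed.

(** The cell is determined by any of its points, hence distinct cells are
    disjoint. *)
Lemma cell_truncn B K (z : {ffun 'I_d -> 'I_K}) x i : cell B z x ->
  z i = Num.truncn ((x ord0 i + B%:R) * d%:R) :> nat.
Proof.
move=> /(_ i); rewrite in_itv/= => /andP[h1 h2]; apply/esym/truncn_def.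
move: h1 h2; rewrite lerBlDr ltrBrDr ler_pdivrMr// ltr_pdivlMr//.
by move=> -> ->.
Qed.

Lemma measurable_enlargement S (r : R) : S !=set0 ->
  measurable [set x | set_dist S x <= r].
Proof.
move=> S0; rewrite -[X in measurable X]setTI.
apply: (measurable_fun_le (g := cst r)) => //; exact: measurable_set_dist.
Qed.

(** The boxes are centred at corners of the cells which meet S. These cells are
    contained in the 1-enlargement of S, they are disjoint, and each has volume
    d^-d: comparing volumes bounds their number. *)
Lemma unit_box_cover S : S !=set0 -> compact S ->
  exists N (c : 'I_N -> 'rV[R]_d),
    (forall u, S u -> exists j, forall i, `|u ord0 i - c j ord0 i| <= 1) /\
    (N%:R%:E <= (d%:R ^+ d)%:E * @lebesgue_rV R d (enlargement1 S))%E.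
Proof.
move=> S0 /compact_coord_bounded[B SB].
pose K := (2 * B * d).+1.
pose T := [set z : {ffun 'I_d -> 'I_K} | `[< exists u, S u /\ cell B z u >]]%SET.
pose ev (j : 'I_#|T|) : {ffun 'I_d -> 'I_K} := enum_val j.
exists #|T|, (fun j => \row_i ((ev j i)%:R / d%:R - B%:R)); split.
  move=> u Su.
  have u0 i : 0 <= (u ord0 i + B%:R) * d%:R.
    rewrite mulr_ge0//; have := SB u Su i; rewrite ler_norml => /andP[]; lra.
  have uK i : (Num.truncn ((u ord0 i + B%:R) * d%:R) < K)%N.
    rewrite truncn_lt_nat ?u0//; apply: (@le_lt_trans _ _ (2 * B * d)%:R); last first.
      by rewrite ltr_nat.
    rewrite !natrM ler_wpM2r//.
    have := SB u Su i; rewrite ler_norml => /andP[]; lra.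
  pose z : {ffun 'I_d -> 'I_K} := [ffun i => Ordinal (uK i)].
  have cz : cell B z u.
    move=> i; rewrite in_itv/= ffunE/= lerBlDr ltrBrDr ler_pdivrMr// ltr_pdivlMr//.
    by rewrite truncn_le ?u0// truncnS_gt.
  have zT : z \in T by rewrite inE; apply/asboolP; exists u.
  exists (enum_rank_in zT z) => i; rewrite mxE /ev enum_rankK_in//.
  have /andP[] := cz i; rewrite bnd_simp/= -[(z i).+1]addn1 natrD mulrDl.
  have : 1 / d%:R <= 1 :> R by rewrite ler_pdivrMr// mul1r ler1n.
  by rewrite ler_norml !bnd_simp; lra.
pose F j := cell B (ev j).
have mF j : measurable (F j) by exact: measurable_cell.
have tF : trivIset setT F.
  apply/trivIsetP => i j _ _ ij; apply/seteqP; split => // x [xi xj].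
  move/eqP: ij; apply; apply/enum_val_inj/ffunP => k; apply/val_inj.
  exact: etrans (cell_truncn k xi) (esym (cell_truncn k xj)).
have mU : measurable (\big[setU/set0]_(k < #|T|) F k).
  by apply: bigsetU_measurable.
have := @measure_semi_additive_ord _ _ _ (@lebesgue_rV R d) _ _ mF tF mU.
rewrite (eq_bigr (fun=> (d%:R ^- d)%:E)); last by move=> j _; exact: cell_volume.
rewrite sumEFin sumr_const card_ord -(mulr_natl (d%:R ^- d)) => E.
have : ((#|T|%:R * d%:R ^- d)%:E <= @lebesgue_rV R d (enlargement1 S))%E.
  rewrite -E; apply: le_measure; rewrite ?inE//; first exact: measurable_enlargement.
  rewrite -bigcup_seq => x [j _] xj.
  have := enum_valP j; rewrite inE => /asboolP[u [Su uj]].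
  rewrite /enlargement1/=; apply: le_trans (set_dist_le x Su) _.
  apply: le_trans (enorm_le_max (e := d%:R^-1) _) _; last by rewrite mulfV ?gt_eqF.
  move=> i; rewrite !mxE; move: (xj i) (uj i); rewrite !in_itv/=.
  rewrite -[(ev j i).+1]addn1 natrD mulrDl.
  by rewrite ler_norml => /andP[? ?] /andP[? ?]; lra.
rewrite -(lee_pmul2l (_ : (d%:R ^+ d)%:E \is a fin_num)) ?lte_fin ?exprn_gt0//.
by rewrite -EFinM mulrCA divff ?mulr1// expf_neq0 ?gt_eqF.
Qed.

Lemma enlargement_box S N (c : 'I_N -> 'rV[R]_d) : S !=set0 ->
  (forall u, S u -> exists j, forall i, `|u ord0 i - c j ord0 i| <= 1) ->
  forall (r : R) x, set_dist S x <= r ->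
    exists j, forall i, `|x ord0 i - c j ord0 i| <= r + 2.
Proof.
move=> S0 Sc r x xr; have [u Su ux] := set_dist_adherent x S0 ltr01.
have [j jc] := Sc u Su; exists j => i.
rewrite -(subrKA (u ord0 i)) (le_trans (ler_normD _ _))//.
have := jc i; have := le_coord_enorm (x - u) i; rewrite !mxE; lra.
Qed.

Lemma enlargement_volume S N (c : 'I_N -> 'rV[R]_d) : S !=set0 ->
  (forall u, S u -> exists j, forall i, `|u ord0 i - c j ord0 i| <= 1) ->
  forall r : R, 2 <= r ->
  (@lebesgue_rV R d [set x | (set_dist S x <= r)%R] <= (N%:R * (4 * r) ^+ d)%:E)%E.
Proof.
move=> S0 Sc r r2.
pose I j i := `[c j ord0 i - (r + 2), c j ord0 i + (r + 2)]%R : interval R.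
pose F j := [set x : 'rV[R]_d | forall i, [set` I j i] (x ord0 i)].
have mF j : measurable (F j) by exact: (measurable_box (fun i => measurable_itv (I j i))).
have vF j : (@lebesgue_rV R d (F j) <= ((4 * r) ^+ d)%:E)%E.
  rewrite (lebesgue_rV_box (fun i => measurable_itv (I j i))).
  rewrite (eq_bigr (fun=> (2 * (r + 2))%:E)).
    by rewrite prodEFin prodr_const card_ord lee_fin lerXn2r ?nnegrE; lra.
  move=> i _; rewrite lebesgue_measure_itv/= lte_fin ifT -?EFinB; last by lra.
  by congr EFin; lra.
apply: (@le_trans _ _ (\sum_j @lebesgue_rV R d (F j))%E).
  apply: measure_le_sum => //; first exact: measurable_enlargement.
  move=> x xr; have [j jx] := enlargement_box S0 Sc xr; exists j => i /=.
  by have := jx i; rewrite ler_norml in_itv/=; lra.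
apply: (@le_trans _ _ (\sum_(j < N) ((4 * r) ^+ d)%:E)%E); first exact: lee_sum.
by rewrite sumEFin sumr_const card_ord -(mulr_natl (_ ^+ d)).
Qed.

Lemma interval_grid (M a : R) : 0 <= M -> 0 < a -> exists (q : nat) (e : 'I_q -> R),
  (forall t, `|t| <= M -> exists j, `|t - e j| <= a) /\ q%:R <= M / a + 1.
Proof.
move=> M0 a0; pose q := (Num.truncn (M / a)).+1.
exists q, (fun j => - M + (2 * j%:R + 1) * a); split; last first.
  by rewrite /q -addn1 natrD lerD2r truncn_le// divr_ge0// ltW.
move=> t; rewrite ler_norml => /andP[t1 t2].
have s0 : 0 <= (t + M) / (2 * a) by rewrite divr_ge0//; lra.
have jq : (Num.truncn ((t + M) / (2 * a)) < q)%N.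
  rewrite ltnS; apply: le_truncn; rewrite invfM mulrA ler_wpM2r ?invr_ge0//; first exact: ltW.
  lra.
exists (Ordinal jq) => /=.
have := truncn_itv s0; set j := Num.truncn _.
rewrite ler_pdivlMr ?ltr_pdivrMr ?mulr_gt0// -addn1 natrD ler_norml.
by move=> /andP[]; nra.
Qed.

(** A box of half-width M + 2 around each unit box is subdivided into boxes of
    half-width a; the number of steps per direction is at most
    (M + 2) / a + 1 <= 3 M / a. *)
Lemma cell_centers S N (c : 'I_N -> 'rV[R]_d) : S !=set0 ->
  (forall u, S u -> exists j, forall i, `|u ord0 i - c j ord0 i| <= 1) ->
  forall M a : R, 2 <= M -> 0 < a -> a <= M ->
  exists (I : finType) (e : I -> 'rV[R]_d),
    (forall x, set_dist S x <= M -> exists j, forall i, `|x ord0 i - e j ord0 i| <= a) /\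
    #|I|%:R <= N%:R * (3 * M / a) ^+ d.
Proof.
move=> S0 Sc M a M2 a0 aM.
have [q [g [gM qM]]] := @interval_grid (M + 2) a ltac:(lra) a0.
exists ('I_N * {ffun 'I_d -> 'I_q})%type.
exists (fun p : 'I_N * {ffun 'I_d -> 'I_q} => \row_i (c p.1 ord0 i + g (p.2 i))); split.
  move=> x xM; have [j jM] := enlargement_box S0 Sc xM.
  have gj i := gM _ (jM i).
  exists (j, [ffun i => projT1 (cid (gj i))]) => i; rewrite mxE ffunE.
  by case: cid => k /=; rewrite opprD addrA.
rewrite card_prod card_ffun !card_ord natrM natrX ler_wpM2l//.
rewrite lerXn2r ?nnegrE// ?divr_ge0//; [lra|lra|].
apply: le_trans qM _; rewrite -{2}(divff (lt0r_neq0 a0)) -mulrDl.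
by rewrite ler_pM2r ?invr_gt0//; lra.
Qed.

End cells.

(** * Metric entropy of Gaussian mixtures *)

Section code.
Context (R : realType) (d : nat).
Implicit Types (G : probability 'rV[R]_d R) (c x : 'rV[R]_d).

(** The coefficient, as a function of the centre m of the Gaussian, in the
    expansion of x |-> e^(-|x - m|^2/2) around c; the sign comes from e^(-yu). *)
Definition signed_monomial K (k : {ffun 'I_d -> 'I_K}) c (m : 'rV[R]_d) : R :=
  \prod_i ((-1) ^+ k i) * gauss_monomial_prod k (fun i => c ord0 i - m ord0 i).

Definition mixture_coef G c K (k : {ffun 'I_d -> 'I_K}) : R :=
  \int[G]_m signed_monomial k c m.

Lemma signed_monomial_le1 K (k : {ffun 'I_d -> 'I_K}) c m :
  `|signed_monomial k c m| <= 1.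
Proof.
rewrite normrM normr_prod big1 ?mul1r ?gauss_monomial_prod_le1// => i _.
by rewrite normrX normrN1 expr1n.
Qed.

Lemma measurable_signed_monomial K (k : {ffun 'I_d -> 'I_K}) c :
  measurable_fun setT (signed_monomial k c).
Proof.
apply: measurable_funM => //; apply: measurable_prod => i _.
apply: measurableT_comp; first exact: measurable_gauss_monomial.
by apply: measurable_funB => //; exact: measurable_rV_coord.
Qed.

Lemma integrable_signed_monomial G K (k : {ffun 'I_d -> 'I_K}) c :
  G.-integrable setT (EFin \o signed_monomial k c).
Proof.
apply: (@bounded_integrable _ _ _ _ 1); first exact: measurable_signed_monomial.
exact: signed_monomial_le1.
Qed.

Lemma Rintegral_le_bound G (f : 'rV[R]_d -> R) (B : R) :
  measurable_fun setT f -> (forall x, `|f x| <= B) -> `|\int[G]_x f x| <= B.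
Proof.
move=> mf fB; have If := bounded_integrable G mf fB.
apply: le_trans (le_normr_Rintegral measurableT If) _.
apply: (@le_trans _ _ (\int[G]_x B)); last first.
  by rewrite Rintegral_cst// [X in fine X]probability_setT mulr1.
apply: le_Rintegral => //.
- apply: (@bounded_integrable _ _ _ _ B); first exact: measurableT_comp.
  by move=> x; rewrite normr_id.
- by apply: (@bounded_integrable _ _ _ _ `|B|).
Qed.

Lemma mixture_coef_le1 G c K (k : {ffun 'I_d -> 'I_K}) : `|mixture_coef G c k| <= 1.
Proof.
apply: Rintegral_le_bound; first exact: measurable_signed_monomial.
exact: signed_monomial_le1.
Qed.

Lemma Rintegral_sum G (I : Type) (s : seq I) (F : I -> 'rV[R]_d -> R) :
  (forall i, G.-integrable setT (EFin \o F i)) ->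
  \int[G]_x (\sum_(i <- s) F i x) = \sum_(i <- s) \int[G]_x F i x.
Proof.
move=> iF; elim: s => [|i s IH].
  by rewrite big_nil; under eq_Rintegral do rewrite big_nil; rewrite Rintegral_cst// mul0r.
under eq_Rintegral do rewrite big_cons.
rewrite RintegralD//; first by rewrite big_cons IH.
rewrite (_ : _ \o _ = (fun x => \sum_(i <- s) (F i x)%:E)%E); last first.
  by apply/funext => x /=; rewrite sumEFin.
exact: (@integrable_sum _ _ _ G setT measurableT _ s xpredT
  (fun i x => (F i x)%:E) (fun i _ => iF i)).
Qed.

(** Integrating the expansion of the kernel over the mixing measure: near c, a
    mixture density is determined up to a small error by finitely many
    coefficients, all in [-1, 1]. The same expansion serves every mixing measure,
    because the remainder is uniform in the centre of the Gaussian. *)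
Lemma mixture_density_approx G c x K (delta : R) :
  0 <= delta -> delta <= 1 ->
  (forall i, (2 * (x ord0 i - c ord0 i) ^+ 2) ^+ K / K`!%:R *
     expR ((x ord0 i - c ord0 i) ^+ 2) <= delta ^+ 2) ->
  `|mixture_density G x - normal_const R d *
    \sum_(k : {ffun 'I_d -> 'I_K})
      mixture_coef G c k * gauss_monomial_prod k (fun i => x ord0 i - c ord0 i)| <=
  2 ^+ d * delta.
Proof.
move=> d0 d1 hx; set u := fun i => x ord0 i - c ord0 i.
have iS (k : {ffun 'I_d -> 'I_K}) :
    G.-integrable setT (EFin \o (fun m => signed_monomial k c m * gauss_monomial_prod k u)).
  apply: (@bounded_integrable _ _ _ _ 1).
    by apply: measurable_funM => //; exact: measurable_signed_monomial.
  by move=> m; rewrite normrM mulr_ile1// ?signed_monomial_le1 ?gauss_monomial_prod_le1.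
pose T m := \sum_(k : {ffun 'I_d -> 'I_K}) signed_monomial k c m * gauss_monomial_prod k u.
have mT : measurable_fun setT T.
  apply: measurable_sum => k; apply: measurable_funM => //.
  exact: measurable_signed_monomial.
have bT m : `|T m| <= #|{ffun 'I_d -> 'I_K}|%:R.
  apply: le_trans (ler_norm_sum _ _ _) _.
  rewrite -sum1_card natr_sum; apply: ler_sum => k _.
  by rewrite normrM mulr_ile1// ?signed_monomial_le1 ?gauss_monomial_prod_le1.
have -> : \sum_(k : {ffun 'I_d -> 'I_K}) mixture_coef G c k * gauss_monomial_prod k u =
    \int[G]_m T m.
  rewrite Rintegral_sum//; apply: eq_bigr => k _.
  by rewrite RintegralZr//; exact: integrable_signed_monomial.
have iT := bounded_integrable G mT bT.
rewrite -RintegralZl// /mixture_density -RintegralB//; last 2 first.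
- exact: integrable_std_normal.
- apply: (@bounded_integrable _ _ _ _ (normal_const R d * #|{ffun 'I_d -> 'I_K}|%:R)).
    exact: measurable_funM.
  by move=> m; rewrite normrM gtr0_norm ?normal_const_gt0// ler_pM2l ?normal_const_gt0.
apply: Rintegral_le_bound.
  apply: measurable_funB; first exact: measurable_std_normal_r.
  exact: measurable_funM.
move=> m; rewrite std_normal_density_prod -mulrBr normrM.
rewrite gtr0_norm ?normal_const_gt0//.
have := gauss_kernel_approx (fun i => c ord0 i - m ord0 i) d0 d1 hx.
rewrite (eq_bigr (fun i => expR (- (x ord0 i - m ord0 i) ^+ 2 / 2))); last first.
  by move=> i _; rewrite [c ord0 i - _ + _]addrC subrKA.
move=> H; under eq_bigr do rewrite !mxE.
apply: le_trans (ler_wpM2l (ltW (normal_const_gt0 R d)) H) _.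
by rewrite ler_piMl ?normal_const_le1// mulr_ge0// exprn_ge0.
Qed.

(** The coefficients around every point e i, rounded to multiples of 1 / W.
    The shift by 1 makes them nonnegative. *)
Definition mixture_code (I : finType) (e : I -> 'rV[R]_d) (K W : nat) G :
    {ffun (I * {ffun 'I_d -> 'I_K}) -> 'I_(2 * W).+1} :=
  [ffun p => inord (Num.truncn ((mixture_coef G (e p.1) p.2 + 1) * W%:R))].

Lemma mixture_code_coef (I : finType) (e : I -> 'rV[R]_d) (K W : nat) G G' j
    (k : {ffun 'I_d -> 'I_K}) :
  (0 < W)%N -> mixture_code e K W G = mixture_code e K W G' ->
  `|mixture_coef G (e j) k - mixture_coef G' (e j) k| <= W%:R^-1.
Proof.
move=> W0 /ffunP/(_ (j, k)); rewrite !ffunE => /(congr1 val)/=.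
(* The rounded values are in the range of inord, so no default value occurs. *)
have bnd H : (Num.truncn ((mixture_coef H (e j) k + 1) * W%:R) < (2 * W).+1)%N.
  rewrite ltnS -[X in (_ <= X)%N](@natrK R); apply: le_truncn.
  rewrite natrM ler_wpM2r//; have := mixture_coef_le1 H (e j) k.
  by rewrite ler_norml => /andP[_]; lra.
have W0R : 0 < W%:R :> R by rewrite ltr0n.
have nn H : 0 <= (mixture_coef H (e j) k + 1) * W%:R.
  rewrite mulr_ge0//; have := mixture_coef_le1 H (e j) k.
  by rewrite ler_norml => /andP[]; lra.
rewrite !inordK ?bnd// => E.
have := truncn_itv (nn G); have := truncn_itv (nn G'); rewrite E.
move=> /andP[a1 a2] /andP[b1 b2].
rewrite -[X in `|X|](mulfK (lt0r_neq0 W0R)) normrM [X in _ * X]gtr0_norm ?invr_gt0//.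
rewrite ler_piMl ?invr_ge0// ler_norml; move: a1 a2 b1 b2; rewrite -addn1 natrD; lra.
Qed.

Lemma mixture_code_density (I : finType) (e : I -> 'rV[R]_d) (K W : nat) (delta : R) G G' :
  (0 < W)%N -> mixture_code e K W G = mixture_code e K W G' ->
  0 <= delta -> delta <= 1 ->
  forall j x,
  (forall i, (2 * (x ord0 i - e j ord0 i) ^+ 2) ^+ K / K`!%:R *
     expR ((x ord0 i - e j ord0 i) ^+ 2) <= delta ^+ 2) ->
  `|mixture_density G x - mixture_density G' x| <=
   2 * (2 ^+ d * delta) + K%:R ^+ d / W%:R.
Proof.
move=> W0 GG' d0 d1 j x hx.
have := mixture_density_approx G d0 d1 hx.
have := mixture_density_approx G' d0 d1 hx.
set u := fun i => x ord0 i - _; set s' := \sum_k _; set s := \sum_k _ => h' h.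
have ss : `|normal_const R d * s - normal_const R d * s'| <= K%:R ^+ d / W%:R.
  rewrite -mulrBr normrM gtr0_norm ?normal_const_gt0//.
  have H : `|s - s'| <= K%:R ^+ d / W%:R.
    rewrite -sumrB; apply: le_trans (ler_norm_sum _ _ _) _.
    apply: (@le_trans _ _ (\sum_(k : {ffun 'I_d -> 'I_K}) W%:R^-1)).
      apply: ler_sum => k _; rewrite -mulrBl normrM.
      apply: le_trans (mixture_code_coef j k W0 GG').
      by rewrite ler_piMr// gauss_monomial_prod_le1.
    by rewrite sumr_const card_ffun !card_ord -[leLHS]mulr_natl natrX.
  apply: le_trans H; rewrite ler_piMl// normal_const_le1//.
move: h h' ss; rewrite !ler_norml => /andP[? ?] /andP[? ?] /andP[? ?]; lra.
Qed.

End code.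

Lemma expR_half_le2 (R : realType) : expR (2^-1) <= 2 :> R.
Proof.
have := expR_ge1Dx (- 2^-1 : R); rewrite expRN => H.
have e0 := expR_gt0 (2^-1 : R).
have : (1 - 2^-1) * expR 2^-1 <= 1 :> R.
  by rewrite -ler_pdivlMr// mul1r.
lra.
Qed.

Section log_sample_size.
Context (R : realType) (n : nat).
Hypothesis n2 : (2 <= n)%N.
Local Notation L := (ln n%:R : R).

Lemma natR_ge2 : 2 <= n%:R :> R. Proof. by rewrite (ler_nat R 2). Qed.

Lemma ln_nat_ge_half : 2^-1 <= L.
Proof.
rewrite -[leLHS]expRK ler_ln ?posrE ?expR_gt0 ?ltr0n ?(ltn_trans _ n2)//.
exact: le_trans (expR_half_le2 R) natR_ge2.
Qed.

Lemma expR_ln_nat : expR L = n%:R.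
Proof. by rewrite lnK// posrE ltr0n (ltn_trans _ n2). Qed.

Lemma ln_nat_le : L <= n%:R.
Proof. by have := expR_ge1Dx L; rewrite expR_ln_nat; lra. Qed.

Lemma expRM_ln_nat k : expR (k%:R * L) = n%:R ^+ k.
Proof. by rewrite expRM_natl expR_ln_nat. Qed.
End log_sample_size.

(** Write a for the square root of ln n. The code records about ln n coefficients
    per direction, rounded at a scale polynomial in 1 / n, around points whose
    boxes of half-width a cover the M-enlargement of S. The number of points is of order
    Vol(S^1) (M / a)^d, the number of coefficients at each of them of order
    a^(2 d), and the logarithm of the number of values of a coefficient of order
    a^2: the product is Vol(S^1) M^d a^(d + 2), the logarithm of the number of
    codes. *)
Lemma mixture_entropy (R : realType) d : (0 < d)%N ->
  exists2 C : R, 0 < C &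
  forall (n : nat) (M V : R) (S : set 'rV[R]_d), (2 <= n)%N ->
    Num.sqrt (ln n%:R) <= M -> 2 <= M -> S !=set0 -> compact S ->
    @lebesgue_rV R d (enlargement1 S) = V%:E ->
  exists (J : finType) (code : probability 'rV[R]_d R -> J),
    (forall G G', code G = code G' -> forall x, set_dist S x <= M ->
       `|mixture_density G x - mixture_density G' x| <= (n%:R ^- 2)) /\
    #|J|%:R <= expR (C * (V * M ^+ d * Num.sqrt (ln n%:R) ^+ (d + 2))).
Proof.
move=> d0.
(* The part 2 e^3 is what the remainder of the expansion asks for; the part d + 5
   gains the factor n^-3 over the constant 2^(d + 1). *)
pose B : R := 2 * expR 3 + d%:R + 5.
pose B' : nat := (Num.truncn B).+3.
have e3 : 0 < expR 3 :> R := expR_gt0 _.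
have BB' : B + 2 <= B'%:R.
  by rewrite /B' -natr1 -natr1; have := truncnS_gt B; lra.
have dR : 0 <= d%:R :> R by [].
have B'1 : 1 <= B'%:R :> R by rewrite ler1n.
pose Cw : R := 2 * ln (3 * B'%:R ^+ d) + d%:R + 3.
have lnB : 0 <= ln (3 * B'%:R ^+ d) :> R.
  rewrite ln_ge0// -[leLHS]mulr1 ler_pM ?exprn_ege1//; lra.
exists (d%:R ^+ d * 3 ^+ d * B'%:R ^+ d * Cw).
  rewrite !mulr_gt0 ?exprn_gt0 ?ltr0n//; last by rewrite /Cw; lra.
move=> n M V S n2 aM M2 S0 cS hV.
set L := ln n%:R; set a := Num.sqrt L.
have L1 : 2^-1 <= L := ln_nat_ge_half R n2.
have aL : a ^+ 2 = L by rewrite sqr_sqrtr//; lra.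
have a0 : 0 < a by rewrite sqrtr_gt0; lra.
have nR : 2 <= n%:R :> R := natR_ge2 R n2.
have Ln : L <= n%:R := ln_nat_le R n2.
have [N [c [Sc NV]]] := unit_box_cover d0 S0 cS.
have [I [e [Ie IN]]] := cell_centers S0 Sc M2 a0 aM.
pose K := (Num.truncn (B * L)).+1.
(* The errors of the K^d rounded coefficients add up to K^d / W <= n^-3. *)
pose W := (B' ^ d * n ^ (d + 3))%N.
have W0 : (0 < W)%N by rewrite muln_gt0 !expn_gt0 (ltn_trans _ n2).
have BL0 : 0 <= B * L by rewrite mulr_ge0// /B; lra.
have KB : B * L <= K%:R by rewrite ltW// truncnS_gt.
have KB' : K%:R <= B'%:R * L.
  rewrite /K -addn1 natrD; have : (Num.truncn (B * L))%:R <= B * L by rewrite truncn_le.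
  by nra.
pose delta := expR (- K%:R + L / 2).
have hd1 : 2 * (2 ^+ d * delta) <= n%:R ^- 3.
  rewrite mulrA -exprS; apply: (@le_trans _ _ (n%:R ^+ d.+1 * delta)).
    by rewrite ler_wpM2r ?expR_ge0// lerXn2r ?nnegrE.
  rewrite -!expRM_ln_nat// -expRN -expRD ler_expR -/L -(natr1 d).
  have : (2 * expR 3 + d%:R + 5) * L <= K%:R by [].
  by nra.
have n0 : 0 < n%:R :> R by lra.
have hd2 : K%:R ^+ d / W%:R <= n%:R ^- 3 :> R.
  rewrite /W natrM !natrX exprD mulrA -exprMn invfM mulrA ler_piMl//.
  have B'n0 : 0 < (B'%:R * n%:R) ^+ d :> R.
    by rewrite exprn_gt0// mulr_gt0// (lt_le_trans ltr01).
  rewrite ler_pdivrMr// mul1r lerXn2r ?nnegrE ?mulr_ge0//.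
  by apply: le_trans KB' _; rewrite ler_wpM2l.
have d1 : delta <= 1.
  rewrite -expR0 ler_expR; have : (2 * expR 3 + d%:R + 5) * L <= K%:R by [].
  by nra.
exists {ffun (I * {ffun 'I_d -> 'I_K}) -> 'I_(2 * W).+1}, (mixture_code e K W); split.
  move=> G G' GG' x xM; have [j jx] := Ie x xM.
  apply: le_trans (mixture_code_density W0 GG' (expR_ge0 _) d1 (j := j) _) _.
    move=> i; apply: gauss_remainder_small; [lra| |].
      by rewrite -aL; have := jx i; rewrite ler_norml => /andP[]; nra.
    have : (2 * expR 3 + d%:R + 5) * L <= K%:R by [].
    by nra.
  apply: le_trans (lerD hd1 hd2) _.
  rewrite -!exprVn; set r : R := n%:R^-1.
  have r2 : 0 <= 1 - 2 * r by rewrite subr_ge0 ler_pdivrMr// mul1r.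
  by have := mulr_ge0 (sqr_ge0 r) r2; lra.
rewrite card_ffun card_prod card_ffun !card_ord.
have V0 : 0 <= V by rewrite -lee_fin -hV.
have NV' : N%:R <= d%:R ^+ d * V by move: NV; rewrite hV -EFinM lee_fin.
have W1 : 0 < (2 * W).+1%:R :> R by [].
have lnW : ln (2 * W).+1%:R <= Cw * L :> R.
  apply: (@le_trans _ _ (ln (3 * B'%:R ^+ d * n%:R ^+ (d + 3)))).
    rewrite ler_ln ?posrE ?mulr_gt0 ?exprn_gt0 ?ltr0n ?(ltn_trans _ n2)//.
    rewrite -mulrA -!natrX -natrM -/W -natrM ler_nat.
    by rewrite -addn1 mulSn addnC leq_add2r.
  rewrite lnM ?posrE ?mulr_gt0 ?exprn_gt0 ?ltr0n ?(ltn_trans _ n2)//.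
  rewrite lnXn ?ltr0n ?(ltn_trans _ n2)// -/L -(mulr_natl L) natrD /Cw.
  by nra.
rewrite natrX -[X in X ^+ _ <= _]lnK ?posrE// -expRM_natl ler_expR natrM natrX.
have lnW0 : 0 <= ln (2 * W).+1%:R :> R by rewrite ln_ge0// ler1n.
have M0 : 0 <= M by lra.
apply: (@le_trans _ _ (d%:R ^+ d * V * (3 * M / a) ^+ d * (B'%:R * L) ^+ d * (Cw * L))).
  apply: ler_pM => //; last apply: ler_pM => //.
  - apply: le_trans IN _; rewrite ler_wpM2r// exprn_ge0// divr_ge0 ?mulr_ge0//.
    exact: ltW.
  - by rewrite lerXn2r ?nnegrE// (le_trans _ KB').
have -> : (B'%:R * L) ^+ d = B'%:R ^+ d * (a ^+ d) ^+ 2.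
  by rewrite exprMn -aL -!exprM mulnC.
have -> : (3 * M / a) ^+ d = 3 ^+ d * M ^+ d / a ^+ d by rewrite !exprMn exprVn.
rewrite -[X in Cw * X]aL exprD.
have ad0 : a ^+ d != 0 by rewrite expf_neq0 ?gt_eqF.
rewrite le_eqVlt; apply/orP; left; apply/eqP.
by move: (a ^+ d) ad0 => b b0; field.
Qed.

(** * The envelope and the tail of a mixture *)

Section envelope.
Context (R : realType) (d : nat) (S : set 'rV[R]_d) (M : R).
Hypotheses (d0 : (0 < d)%N) (S0 : S !=set0) (M2 : 2 <= M).

(** Raised to the power -(d + 1), this is an integrable envelope, constant where
    the code controls the densities. *)
Definition excess (x : 'rV[R]_d) : R := Num.max 1 (set_dist S x / M).

Lemma excess_ge1 x : 1 <= excess x.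
Proof. by rewrite /excess le_max lexx. Qed.

Let M0 : 0 < M. Proof. by apply: lt_le_trans M2. Qed.

Lemma excess_in x : set_dist S x <= M -> excess x = 1.
Proof. by move=> xM; apply/max_idPl; rewrite ler_pdivrMr// mul1r. Qed.

Lemma excess_out x : M < set_dist S x -> excess x = set_dist S x / M.
Proof. by move=> xM; apply/max_idPr; rewrite ler_pdivlMr// mul1r ltW. Qed.

Lemma measurable_excess : measurable_fun setT excess.
Proof.
apply: measurable_maxr => //; apply: measurable_funM => //.
exact: measurable_set_dist.
Qed.

Lemma measurable_excessVX k : measurable_fun setT (fun x => excess x ^- k).
Proof.
rewrite (_ : (fun _ => _) = (fun x => expR (- (k%:R * ln (excess x))))).
  apply: measurableT_comp => //; apply: measurableT_comp => //.
  apply: measurable_funM => //; apply: measurableT_comp => //.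
  exact: measurable_excess.
apply/funext => x; rewrite expRN expRM_natl lnK// posrE.
exact: lt_le_trans (excess_ge1 x).
Qed.

Let dyadic (j : nat) (x : 'rV[R]_d) : \bar R :=
  ((2 ^- (j * d.+1)) * \1_[set x | set_dist S x <= 2 ^+ j.+1 * M] x)%:E.

Let dyadic_ge0 j x : (0 <= dyadic j x)%E.
Proof. by rewrite lee_fin mulr_ge0. Qed.

Let measurable_ball j : measurable [set x | set_dist S x <= 2 ^+ j.+1 * M].
Proof. exact: measurable_enlargement. Qed.

(** Only the shell 2^j <= excess < 2^(j + 1) which contains x matters. *)
Let excess_dyadic x : ((excess x ^- d.+1)%:E <= \sum_(j <oo) dyadic j x)%E.
Proof.
set y := excess x; pose j := trunc_log 2 (Num.truncn y).
have y1 : 1 <= y := excess_ge1 x.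
have ty : (0 < Num.truncn y)%N by rewrite truncn_gt_nat.
have /andP[j1 j2] := trunc_log_bounds (isT : (1 < 2)%N) ty.
have h1 : 2 ^+ j <= y.
  apply: (@le_trans _ _ (Num.truncn y)%:R); last by rewrite truncn_le (le_trans _ y1).
  by rewrite -natrX ler_nat.
have h2 : y < 2 ^+ j.+1.
  apply: lt_le_trans (truncnS_gt y) _.
  by rewrite -natrX ler_nat.
apply: (@le_trans _ _ (dyadic j x)); last first.
  apply: (@le_trans _ _ (\sum_(0 <= i < j.+1) dyadic i x)%E).
    by rewrite big_nat_recr//= leeDr// sume_ge0.
  by apply: nneseries_lim_ge.
rewrite /dyadic indicE mem_set/=; last first.
  rewrite -ler_pdivrMr//; apply: ltW; apply: le_lt_trans h2.
  by rewrite /y /excess le_max lexx orbT.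
rewrite mulr1 lee_fin lef_pV2 ?posrE ?exprn_gt0//; last exact: lt_le_trans y1.
by rewrite exprM lerXn2r ?nnegrE ?exprn_ge0//; exact: le_trans y1.
Qed.

(** The shell number j has a volume of order 2^(j d) and the integrand is at most
    2^(-j (d + 1)) there, so the integral is bounded by a geometric series. *)
Lemma envelope_integral N (c : 'I_N -> 'rV[R]_d) :
  (forall u, S u -> exists j, forall i, `|u ord0 i - c j ord0 i| <= 1) ->
  (\int[@lebesgue_rV R d]_x (excess x ^- d.+1)%:E <=
   (2 * N%:R * (8 * M) ^+ d)%:E)%E.
Proof.
move=> Sc.
have md j : measurable_fun setT (dyadic j).
  by apply/measurable_EFinP; apply: measurable_funM => //; exact: measurable_indic.
apply: (@le_trans _ _ (\int[@lebesgue_rV R d]_x (\sum_(j <oo) dyadic j x))%E).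
  apply: ge0_le_integral => //.
  - by move=> x _; rewrite lee_fin invr_ge0 exprn_ge0// (le_trans _ (excess_ge1 x)).
  - by apply/measurable_EFinP; exact: measurable_excessVX.
  - by apply: ge0_emeasurable_sum.
rewrite integral_nneseries//; apply: lime_le.
  by apply: is_cvg_ereal_nneg_natsum => j _; apply: integral_ge0.
near=> m.
apply: (@le_trans _ _ (\sum_(0 <= j < m) (2 ^- j * (N%:R * (8 * M) ^+ d))%:E)%E).
  apply: lee_sum => j _.
  under eq_integral do rewrite /dyadic EFinM.
  rewrite ge0_integralZl//; last by apply/measurable_EFinP; exact: measurable_indic.
  rewrite integral_indic// setIT.
  have r2 : 2 <= 2 ^+ j.+1 * M.
    by rewrite -[leLHS]mul1r ler_pM// exprn_ege1// ler1n.
  apply: le_trans (lee_wpmul2l _ (enlargement_volume S0 Sc r2)) _.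
    by rewrite lee_fin.
  rewrite -EFinM lee_fin le_eqVlt; apply/orP; left; apply/eqP.
  rewrite (_ : 4 * (2 ^+ j.+1 * M) = 2 ^+ j * (8 * M)); last by rewrite exprS; lra.
  rewrite mulnS exprD exprM [(2 ^+ j * (8 * M)) ^+ d]exprMn.
  have p1 : (2 : R) ^+ j != 0 by rewrite expf_neq0.
  have p2 : ((2 : R) ^+ j) ^+ d != 0 by rewrite expf_neq0.
  by move: (2 ^+ j) p1 p2 => b; move: (b ^+ d) => b' p1 p2; field; rewrite p1 p2.
rewrite sumEFin lee_fin -mulr_suml -mulrA ler_wpM2r ?mulr_ge0 ?exprn_ge0//.
  by rewrite mulr_ge0// ltW.
suff -> : \sum_(0 <= j < m) (2 : R) ^- j = 2 - 2 * 2 ^- m by rewrite gerBl mulr_ge0.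
elim: (m) => [|k IH]; first by rewrite big_nil expr0 invr1 mulr1 subrr.
by rewrite big_nat_recr//= IH exprS invfM; lra.
Unshelve. all: by end_near. Qed.

End envelope.

Section tail.
Context (R : realType) (d : nat) (S : set 'rV[R]_d) (M : R) (n : nat).
Hypotheses (S0 : S !=set0) (n2 : (2 <= n)%N) (M2 : 2 <= M).
Local Notation L := (@ln R n%:R).
Hypothesis ML : 10 * L <= M ^+ 2.
Local Notation p0 := (d.+1%:R / (2 * L)).

Let M0 : 0 < M. Proof. by apply: lt_le_trans M2. Qed.
Let L1 : 2^-1 <= L. Proof. exact: ln_nat_ge_half. Qed.

(** Outside the M-enlargement, e^(2 ln n * log_tail) = n^2 excess^(d + 1) is the
    inverse of the envelope n^-2 excess^-(d + 1). The exponent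
    (d + 1) / (2 ln n) is the smallest one over which the moments in the
    definition of epsilon range. *)
Definition log_tail (x : 'rV[R]_d) : R :=
  if set_dist S x <= M then 0 else 1 + p0 * ln (set_dist S x / M).

(** From w^(d + 1) <= (d + 1)! e^w with w = y^2 / 18. *)
Definition tail_const : R := 18 ^+ d.+1 * d.+1`!%:R.

(** If d_S(x) > M, then either x is closer to m than m is to S, so that
    d_S(x) <= 2 d_S(m) gives the moment term; or |x - m| > M / 2, and the
    condition on M then provides a factor 1 / n from e^(4/9 |x - m|^2), at the
    price of widening the Gaussian. *)
Lemma expR_log_tail_le (x m : 'rV[R]_d) p : p0 <= p ->
  expR (log_tail x) <= 1 + expR 1 * (2 / M * set_dist S m) `^ p +
    expR 1 * tail_const / n%:R * expR (4 / 9 * enorm (x - m) ^+ 2).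
Proof.
move=> p0p; rewrite /log_tail.
have e1 := expR_gt0 (1 : R).
have n0 : 0 < n%:R :> R by rewrite ltr0n (ltn_trans _ n2).
have L0 : 0 < L by apply: lt_le_trans L1; rewrite invr_gt0.
have pp0 : 0 <= p0.
  rewrite divr_ge0 ?mulr_ge0 ?(ltW L0)//.
have A0 : 0 <= expR 1 * (2 / M * set_dist S m) `^ p by rewrite mulr_ge0 ?powR_ge0// ltW.
have C0 : 0 <= tail_const by rewrite mulr_ge0.
have B0 : 0 <= expR 1 * tail_const / n%:R * expR (4 / 9 * enorm (x - m) ^+ 2).
  by rewrite mulr_ge0 ?expR_ge0// divr_ge0 ?mulr_ge0// ltW.
case: ifPn => [_|]; first by rewrite expR0; lra.
rewrite -ltNge => xM; set z := enorm (x - m).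
have xz : set_dist S x <= set_dist S m + z := set_dist_lip x m S0.
have z0 : 0 <= z := enorm_ge0 _.
rewrite expRD.
have xM1 : 1 < set_dist S x / M by rewrite ltr_pdivlMr ?mul1r.
have [zm|zm] := leP z (set_dist S m).
  have b1 : set_dist S x / M <= 2 / M * set_dist S m.
    by rewrite mulrAC ler_pM2r ?invr_gt0//; lra.
  have b0 : 0 < 2 / M * set_dist S m by apply: lt_le_trans b1; lra.
  have : expR (p0 * ln (set_dist S x / M)) <= (2 / M * set_dist S m) `^ p.
    rewrite /powR gt_eqF// ler_expR ler_pM//.
      by rewrite ln_ge0// ltW.
    by rewrite ler_ln ?posrE//; lra.
  rewrite -(ler_pM2l e1); lra.
(* With z = M y / 2 and y > 1, 4/9 z^2 = M^2 y^2 / 9 >= (10/9) ln n * y^2, of which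
   ln n pays for 1 / n and y^2 / 18 for the polynomial. *)
pose y := 2 * z / M.
have xy : set_dist S x / M <= y by rewrite /y ler_pM2r ?invr_gt0//; lra.
have y1 : 1 < y by apply: lt_le_trans xy.
have y0 : 0 < y by lra.
have h1 : expR (p0 * ln (set_dist S x / M)) <= y ^+ 2 ^+ d.+1.
  have yE : expR (ln y) = y by rewrite lnK ?posrE.
  rewrite -exprM -[in leRHS]yE -expRM_natl ler_expR.
  rewrite ler_pM ?ln_ge0 ?(ltW xM1)//.
    rewrite ler_pdivrMr ?mulr_gt0//.
    have : 1 <= d.+1%:R :> R by rewrite ler1n.
    rewrite natrM; move: (d.+1%:R : R) => D D1.
    have : 0 <= D * (L - 2^-1) by rewrite mulr_ge0// ?subr_ge0// (le_trans _ D1).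
    lra.
  by rewrite ler_ln ?posrE//; lra.
have h2 : y ^+ 2 ^+ d.+1 <= tail_const * expR (y ^+ 2 / 18).
  have := @exprn_fact_le_expR _ (y ^+ 2 / 18) d.+1 ltac:(by rewrite divr_ge0// sqr_ge0).
  rewrite exprMn exprVn ler_pdivrMr ?fact_gt0R// ler_pdivrMr ?exprn_gt0// /tail_const.
  by move/le_trans; apply; rewrite le_eqVlt; apply/orP; left; apply/eqP; lra.
have h3 : expR (y ^+ 2 / 18) <= expR (4 / 9 * z ^+ 2) / n%:R.
  rewrite ler_pdivlMr// -[X in _ * X](expR_ln_nat R n2) -expRD ler_expR.
  have -> : z = M * y / 2 by rewrite /y; field; rewrite gt_eqF.
  have y21 : 1 <= y ^+ 2 by rewrite exprn_ege1// ltW.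
  have : 10 * L * y ^+ 2 <= M ^+ 2 * y ^+ 2 by rewrite ler_wpM2r ?sqr_ge0.
  have : 0 <= (L - 2^-1) * y ^+ 2 by rewrite mulr_ge0 ?sqr_ge0// subr_ge0.
  have : 0 <= L * (y ^+ 2 - 1) by rewrite mulr_ge0 ?subr_ge0//; lra.
  lra.
have h4 : expR (p0 * ln (set_dist S x / M)) <= tail_const / n%:R * expR (4 / 9 * z ^+ 2).
  apply: le_trans h1 _; apply: le_trans h2 _.
  by rewrite -mulrA ler_wpM2l// [_^-1 * _]mulrC.
move: h4; rewrite -(ler_pM2l e1); lra.
Qed.

Lemma measurable_log_tail : measurable_fun setT log_tail.
Proof.
apply: measurable_fun_ifT => //.
  apply: (measurable_fun_ler (g := cst M)) => //; exact: measurable_set_dist.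
apply: measurable_funD => //; apply: measurable_funM => //.
apply: measurableT_comp => //; apply: measurable_funM => //.
exact: measurable_set_dist.
Qed.

(** e^(4/9 r^2) e^(-r^2/2) = e^(-r^2/18): the tilted Gaussian has variance 9. *)
Lemma wide_normalE (x m : 'rV[R]_d) :
  expR (4 / 9 * enorm (x - m) ^+ 2) * std_normal_density (x - m) =
  3 ^+ d * \prod_i normal_pdf (m ord0 i) 3 (x ord0 i).
Proof.
have n3 : (3 : R) != 0 by [].
rewrite std_normal_densityE sqr_enorm mulr_sumr expR_sum -big_split/=.
rewrite -[X in _ ^+ X * _](card_ord d) -prodr_const -big_split/=.
apply: eq_bigr => i _; rewrite !mxE -(normal_pdf_sub (m ord0 i))//.
rewrite !normal_pdfE// /normal_fun subr0 expr1n /normal_peak expr1n mul1r.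
set t := x ord0 i - m ord0 i.
have -> : Num.sqrt (3 ^+ 2 * pi *+ 2) = 3 * Num.sqrt (pi *+ 2) :> R.
  by rewrite -mulrnAr sqrtrM ?sqr_ge0// sqrtr_sqr ger0_norm.
rewrite mulrCA -expRD invfM !mulrA mulfV// mul1r; congr (_ * expR _).
lra.
Qed.

(** Conditionally on the centre m, the bound of expR_log_tail_le is integrated
    against the Gaussian; its last term has a finite integral because 4/9 < 1/2. *)
Lemma tail_integral (G : probability 'rV[R]_d R) p : p0 <= p ->
  (\int[@lebesgue_rV R d]_x (expR (log_tail x) * mixture_density G x)%:E <=
   1 + (expR 1)%:E * \int[G]_m ((2 / M * set_dist S m) `^ p)%:E +
   (expR 1 * tail_const * 3 ^+ d / n%:R)%:E)%E.
Proof.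
move=> p0p.
have mg : measurable_fun setT (fun x => (expR (log_tail x))%:E).
  apply/measurable_EFinP; apply: measurableT_comp => //; exact: measurable_log_tail.
under eq_integral do rewrite EFinM.
rewrite integral_mul_mixture//.
pose A m : R := 1 + expR 1 * (2 / M * set_dist S m) `^ p.
have A0 m : 0 <= A m by rewrite addr_ge0// mulr_ge0 ?expR_ge0 ?powR_ge0.
pose B : R := expR 1 * tail_const / n%:R.
have B0 : 0 <= B by rewrite divr_ge0// mulr_ge0 ?expR_ge0// mulr_ge0.
have mpow : measurable_fun setT (fun m : 'rV[R]_d => (2 / M * set_dist S m) `^ p).
  apply: (measurableT_comp (measurable_powR p)); apply: measurable_funM => //.
  exact: measurable_set_dist.
have inner m : (\int[@lebesgue_rV R d]_x
    ((expR (log_tail x))%:E * (std_normal_density (x - m))%:E) <=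
    (A m)%:E + (B * 3 ^+ d)%:E)%E.
  have mw : measurable_fun setT
      (fun x : 'rV[R]_d => \prod_i normal_pdf (m ord0 i) 3 (x ord0 i)).
    apply: measurable_prod => i _; apply: measurableT_comp.
      exact: measurable_normal_pdf.
    exact: measurable_rV_coord.
  apply: (@le_trans _ _ (\int[@lebesgue_rV R d]_x
     ((A m)%:E * (std_normal_density (x - m))%:E +
      (B * 3 ^+ d)%:E * (\prod_i normal_pdf (m ord0 i) 3 (x ord0 i))%:E))%E).
    apply: ge0_le_integral => //.
    - by move=> x _; rewrite -EFinM lee_fin mulr_ge0 ?expR_ge0// ltW ?std_normal_density_gt0.
    - apply: emeasurable_funM => //.
      by apply/measurable_EFinP; exact: measurable_std_normal_l.
    - apply: emeasurable_funD; apply: emeasurable_funM => //; apply/measurable_EFinP => //.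
      exact: measurable_std_normal_l.
    - move=> x _; rewrite -!EFinM -EFinD lee_fin -(mulrA B) -wide_normalE (mulrA B) -mulrDl.
      rewrite ler_pM2r ?std_normal_density_gt0//.
      exact: expR_log_tail_le.
  rewrite ge0_integralD//; last 4 first.
  - by move=> x _; rewrite -EFinM lee_fin mulr_ge0// ltW ?std_normal_density_gt0.
  - apply: emeasurable_funM => //; apply/measurable_EFinP.
    exact: measurable_std_normal_l.
  - move=> x _; rewrite -EFinM lee_fin mulr_ge0 ?mulr_ge0// prodr_ge0// => i _.
    exact: normal_pdf_ge0.
  - by apply: emeasurable_funM => //; apply/measurable_EFinP.
  rewrite ge0_integralZl//; last 3 first.
  - by apply/measurable_EFinP; exact: measurable_std_normal_l.
  - by move=> x _; rewrite lee_fin ltW ?std_normal_density_gt0.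
  - by rewrite lee_fin.
  rewrite integral_std_normal mule1 ge0_integralZl//; last 3 first.
  - exact/measurable_EFinP.
  - move=> x _; rewrite lee_fin prodr_ge0// => i _; exact: normal_pdf_ge0.
  - by rewrite lee_fin mulr_ge0.
  rewrite (integral_lebesgue_rV_prod (g := fun i => normal_pdf (m ord0 i) 3)).
  - by rewrite big1 ?mule1// => i _; exact: integral_normal_pdf.
  - by move=> i; exact: measurable_normal_pdf.
  - by move=> i t; exact: normal_pdf_ge0.
apply: (@le_trans _ _ (\int[G]_m ((A m)%:E + (B * 3 ^+ d)%:E))%E).
  apply: ge0_le_integral => //.
  - move=> m _; apply: integral_ge0 => x _.
    by rewrite -EFinM lee_fin mulr_ge0 ?expR_ge0// ltW ?std_normal_density_gt0.
  - apply: (measurable_fun_fubini_tonelli_G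
      (fun z : 'rV[R]_d * 'rV[R]_d => (expR (log_tail z.1))%:E * (std_normal_density (z.1 - z.2))%:E)%E).
      apply: emeasurable_funM; first exact: (measurableT_comp mg measurable_fst).
      by apply/measurable_EFinP; exact: measurable_std_normal.
    by move=> z; rewrite -EFinM lee_fin mulr_ge0 ?expR_ge0// ltW ?std_normal_density_gt0.
  - apply: emeasurable_funD => //; apply/measurable_EFinP; apply: measurable_funD => //.
    exact: measurable_funM.
rewrite ge0_integralD//; last 3 first.
- by move=> m _; rewrite lee_fin.
- apply/measurable_EFinP; apply: measurable_funD => //; exact: measurable_funM.
- by move=> m _; rewrite lee_fin mulr_ge0.
rewrite integral_cst_prob /A; under eq_integral do rewrite EFinD EFinM.
rewrite ge0_integralD//; last 2 first.
- by move=> m _; rewrite -EFinM lee_fin mulr_ge0 ?expR_ge0 ?powR_ge0.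
- by apply: emeasurable_funM => //; apply/measurable_EFinP.
rewrite integral_cst_prob ge0_integralZl//; last 2 first.
- exact/measurable_EFinP.
- by move=> m _; rewrite lee_fin powR_ge0.
by rewrite /B mulrAC.
Qed.

End tail.

Lemma moment_integral (R : realType) d (S : set 'rV[R]_d) (M p : R)
    (G : {measure set 'rV[R]_d -> \bar R}) : S !=set0 -> 0 < M -> 0 < p ->
  (((2 / M)%:E * moment S G p) `^ p =
   \int[G]_m ((2 / M * set_dist S m) `^ p)%:E)%E.
Proof.
move=> S0 M0 p0.
have M20 : 0 <= 2 / M by rewrite divr_ge0// ltW.
rewrite poweRM ?lee_fin ?poweR_ge0// (poweR_EFin (2 / M)) /moment.
rewrite -poweRrM mulVf ?gt_eqF// poweRe1; last first.
  by apply: integral_ge0 => m _; rewrite lee_fin powR_ge0.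
rewrite -ge0_integralZl//.
- apply: eq_integral => m _; by rewrite -EFinM (powRM _ M20)// set_dist_ge0.
- apply/measurable_EFinP; apply: (measurableT_comp (measurable_powR p)).
  exact: measurable_set_dist.
- by move=> m _; rewrite lee_fin powR_ge0.
- by rewrite lee_fin powR_ge0.
Qed.

(** * Deviation of a mixture with large likelihood *)

Lemma measurable_sqrtr (R : realType) : measurable_fun setT (@Num.sqrt R).
Proof. by apply: continuous_measurable_fun => x; exact: sqrt_continuous. Qed.

Lemma measurable_inv_pos disp (T : measurableType disp) (R : realType) (f : T -> R) :
  (forall x, 0 < f x) -> measurable_fun setT f ->
  measurable_fun setT (fun x => (f x)^-1).
Proof.
move=> f0 mf; rewrite (_ : (fun _ => _) = (fun x => expR (- ln (f x)))).
  apply: measurableT_comp => //; apply: measurableT_comp => //.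
  exact: measurableT_comp.
by apply/funext => x; rewrite expRN lnK// posrE.
Qed.

Section hellinger_affinity.
Context (R : realType) (d : nat).
Implicit Types (f g : 'rV[R]_d -> R).
Local Notation mu := (@lebesgue_rV R d).

Lemma measurable_sqrt_comp f : measurable_fun setT f ->
  measurable_fun setT (fun x => Num.sqrt (f x)).
Proof. by move=> mf; apply: measurableT_comp => //; exact: measurable_sqrtr. Qed.

Lemma measurable_hellinger_integrand f g : measurable_fun setT f ->
  measurable_fun setT g ->
  measurable_fun setT (fun x => ((Num.sqrt (f x) - Num.sqrt (g x)) ^+ 2)%:E).
Proof.
move=> mf mg; apply/measurable_EFinP; apply: measurable_funX.
by apply: measurable_funB; exact: measurable_sqrt_comp.
Qed.

Lemma hellinger2_affinity (G1 G2 : probability 'rV[R]_d R) :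
  let f := mixture_density G1 in let g := mixture_density G2 in
  (hellinger2 f g + 2%:E * \int[mu]_x (Num.sqrt (f x) * Num.sqrt (g x))%:E = 2%:E)%E.
Proof.
move=> f g.
have mf : measurable_fun setT f := measurable_mixture_density G1.
have mg : measurable_fun setT g := measurable_mixture_density G2.
have ms : measurable_fun setT (fun x => (Num.sqrt (f x) * Num.sqrt (g x))%:E).
  by apply/measurable_EFinP; apply: measurable_funM; exact: measurable_sqrt_comp.
have s0 x : (0 <= (Num.sqrt (f x) * Num.sqrt (g x))%:E)%E.
  by rewrite lee_fin mulr_ge0 ?sqrtr_ge0.
rewrite /hellinger2 -ge0_integralZl// -ge0_integralD//; last 3 first.
- by move=> x _; rewrite lee_fin sqr_ge0.
- exact: measurable_hellinger_integrand.
- exact: emeasurable_funM.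
rewrite (eq_integral (fun x => (f x)%:E + (g x)%:E)%E); last first.
  move=> x _; rewrite -EFinM -!EFinD; congr EFin.
  rewrite sqrrB !sqr_sqrtr ?mixture_density_ge0//; lra.
rewrite ge0_integralD//; last 4 first.
- by move=> x _; rewrite lee_fin mixture_density_ge0.
- exact/measurable_EFinP.
- by move=> x _; rewrite lee_fin mixture_density_ge0.
- exact/measurable_EFinP.
by rewrite !integral_mixture_density -EFinD.
Qed.

Lemma hellinger2_ge0 f g : (0 <= hellinger2 f g)%E.
Proof. by apply: integral_ge0 => x _; rewrite lee_fin sqr_ge0. Qed.

Lemma hellinger2_le2 (G1 G2 : probability 'rV[R]_d R) :
  (hellinger2 (mixture_density G1) (mixture_density G2) <= 2%:E)%E.
Proof.
rewrite -(hellinger2_affinity G1 G2) leeDl// mule_ge0 ?lee_fin//.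
by apply: integral_ge0 => x _; rewrite lee_fin mulr_ge0 ?sqrtr_ge0.
Qed.

(** sqrt (h + v) <= sqrt h + sqrt v, and by the arithmetic-geometric inequality
    sqrt v * sqrt f <= (f / n + n v) / 2. These weights are such that for v of
    order n^-2 the perturbation is of order 1 / n, hence bounded after the n-fold
    product. *)
Lemma perturbed_affinity (n : nat) (G Q : probability 'rV[R]_d R)
    (v : 'rV[R]_d -> R) (V T : R) : (0 < n)%N ->
  measurable_fun setT v -> (forall x, 0 <= v x) ->
  (\int[mu]_x (v x)%:E <= V%:E)%E ->
  (T%:E <= hellinger2 (mixture_density G) (mixture_density Q))%E ->
  (\int[mu]_x (Num.sqrt ((mixture_density G x + v x) / mixture_density Q x) *
               mixture_density Q x)%:E <=
   (1 - T / 2 + (n%:R^-1 + n%:R * V) / 2)%:E)%E.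
Proof.
move=> n0 mv v0 vV TH.
set h := mixture_density G; set f := mixture_density Q.
have mh : measurable_fun setT h := measurable_mixture_density G.
have mf : measurable_fun setT f := measurable_mixture_density Q.
have nR : 0 < n%:R :> R by rewrite ltr0n.
have f0 x : 0 < f x by exact: mixture_density_gt0.
have h0 x : 0 < h x by exact: mixture_density_gt0.
have ms : measurable_fun setT (fun x => (Num.sqrt (h x) * Num.sqrt (f x))%:E).
  by apply/measurable_EFinP; apply: measurable_funM; exact: measurable_sqrt_comp.
have s0 x : (0 <= (Num.sqrt (h x) * Num.sqrt (f x))%:E)%E.
  by rewrite lee_fin mulr_ge0 ?sqrtr_ge0.
pose r x := 2^-1 * (n%:R^-1 * f x + n%:R * v x).
have r0 x : 0 <= r x.
  by rewrite mulr_ge0// addr_ge0// mulr_ge0// ?invr_ge0// ltW.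
have mr : measurable_fun setT r.
  by apply: measurable_funM => //; apply: measurable_funD; exact: measurable_funM.
apply: (@le_trans _ _ (\int[mu]_x ((Num.sqrt (h x) * Num.sqrt (f x))%:E + (r x)%:E))%E).
  apply: ge0_le_integral => //.
  - by move=> x _; rewrite lee_fin mulr_ge0 ?sqrtr_ge0// ltW.
  - apply/measurable_EFinP; apply: measurable_funM => //; apply: measurable_sqrt_comp.
    apply: measurable_funM; first exact: measurable_funD.
    exact: measurable_inv_pos.
  - by apply: emeasurable_funD => //; exact/measurable_EFinP.
  - move=> x _; rewrite -EFinD lee_fin.
    rewrite -{2}(sqr_sqrtr (ltW (f0 x))) sqrtrM ?addr_ge0 ?(ltW (h0 x))// sqrtrV ?(ltW (f0 x))//.
    have sf : 0 < Num.sqrt (f x) by rewrite sqrtr_gt0.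
    rewrite expr2 -mulrA (mulrA _^-1) mulVf ?gt_eqF// mul1r.
    have : Num.sqrt (h x + v x) <= Num.sqrt (h x) + Num.sqrt (v x).
      rewrite -ler_sqr ?nnegrE ?addr_ge0 ?sqrtr_ge0// sqrrD !sqr_sqrtr ?addr_ge0 ?(ltW (h0 x))//.
      by rewrite lerD2r lerDl mulrn_wge0// mulr_ge0 ?sqrtr_ge0.
    move=> /(ler_wpM2r (ltW sf)) /le_trans; apply.
    rewrite mulrDl lerD2l /r.
    rewrite -{2}(sqr_sqrtr (ltW (f0 x))) -{2}(sqr_sqrtr (v0 x)).
    set a := Num.sqrt (v x); set b := Num.sqrt (f x).
    have := sqr_ge0 (n%:R * a - b) => H.
    rewrite -(ler_pM2l nR).
    rewrite [leRHS](_ : _ = 2^-1 * (b ^+ 2 + n%:R ^+ 2 * a ^+ 2)); last by field; rewrite gt_eqF.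
    lra.
rewrite ge0_integralD//; last 2 first.
- by move=> x _; rewrite lee_fin.
- exact/measurable_EFinP.
have E : (hellinger2 h f + 2%:E *
    \int[mu]_x (Num.sqrt (h x) * Num.sqrt (f x))%:E = 2%:E)%E :=
  hellinger2_affinity G Q.
have I0 : (0 <= \int[mu]_x (Num.sqrt (h x) * Num.sqrt (f x))%:E)%E by exact: integral_ge0.
have Hr : (\int[mu]_x (r x)%:E <= ((n%:R^-1 + n%:R * V) / 2)%:E)%E.
  under eq_integral do rewrite /r EFinM EFinD !EFinM.
  rewrite ge0_integralZl//; last 2 first.
  - apply: emeasurable_funD; apply: emeasurable_funM => //; exact/measurable_EFinP.
  - move=> x _; rewrite -!EFinM -EFinD lee_fin addr_ge0// mulr_ge0// ?invr_ge0//.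
    exact: ltW.
  rewrite ge0_integralD//; last 4 first.
  - by move=> x _; rewrite -EFinM lee_fin mulr_ge0 ?invr_ge0// ltW.
  - by apply: emeasurable_funM => //; exact/measurable_EFinP.
  - by move=> x _; rewrite -EFinM lee_fin mulr_ge0.
  - by apply: emeasurable_funM => //; exact/measurable_EFinP.
  rewrite ge0_integralZl//; last 2 first.
  - exact/measurable_EFinP.
  - by move=> x _; rewrite lee_fin ltW.
  rewrite ge0_integralZl//; last 2 first.
  - exact/measurable_EFinP.
  - by move=> x _; rewrite lee_fin.
  rewrite integral_mixture_density mule1 mulrC EFinM lee_wpmul2l ?lee_fin ?invr_ge0//.
  by rewrite EFinD leeD2l// EFinM lee_wpmul2l ?lee_fin.
rewrite EFinD; apply: leeD => //.
move: TH E; rewrite -/h -/f; have := hellinger2_le2 G Q; have := hellinger2_ge0 h f.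
rewrite -/h -/f; case: (hellinger2 h f) => [H| |]//.
move: I0; case: (\int[mu]_x _)%E => [I| |]//=; rewrite ?lee_fin.
  by move=> I0 H0 H2 TH; rewrite -EFinM -EFinD => -[]; lra.
by move=> _ _ _ _; rewrite gt0_muley ?lte_fin.
Qed.

End hellinger_affinity.

Section deviation.
Context (R : realType) (d : nat) (disp : measure_display)
  (Omega : measurableType disp) (P : probability Omega R) (n : nat).
Variables (X : 'I_n -> {RV P >-> 'rV[R]_d}) (G : 'I_n -> probability 'rV[R]_d R)
  (Q : probability 'rV[R]_d R) (S : set 'rV[R]_d) (M : R).
Local Notation mu := (@lebesgue_rV R d).
Local Notation L := (@ln R n%:R).
Local Notation f0 := (mixture_density Q).
Hypotheses (n2 : (2 <= n)%N) (S0 : S !=set0) (M2 : 2 <= M).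
Hypothesis indepX : mutually_independent X.
Hypothesis XG : forall i, has_density (X i) (mixture_density (G i)).
Hypothesis GQ : forall x, \sum_(i < n) mixture_density (G i) x = n%:R * f0 x.
Variable fhat : n.-tuple 'rV[R]_d -> 'rV[R]_d -> R.
Hypothesis fhat_mix : forall x, is_mixture_density (fhat x).
Variables (J : finType) (code : probability 'rV[R]_d R -> J).
Hypothesis code_close : forall G1 G2, code G1 = code G2 ->
  forall x, set_dist S x <= M ->
    `|mixture_density G1 x - mixture_density G2 x| <= n%:R ^- 2.

Let M0 : 0 < M. Proof. by apply: lt_le_trans M2. Qed.
Let n0R : 0 < n%:R :> R. Proof. by rewrite ltr0n (ltn_trans _ n2). Qed.
Let L0 : 0 < L.
Proof. by apply: lt_le_trans (ln_nat_ge_half R n2); rewrite invr_gt0. Qed.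

Let env (x : 'rV[R]_d) : R := n%:R ^- 2 * excess S M x ^- d.+1.

Let env_ge0 x : 0 <= env x.
Proof.
rewrite mulr_ge0// invr_ge0 exprn_ge0//.
exact: le_trans (excess_ge1 S M x).
Qed.

Let measurable_env : measurable_fun setT env.
Proof. by apply: measurable_funM => //; exact: measurable_excessVX. Qed.

(** On the M-enlargement, equal codes give an error of at most n^-2, which is the
    envelope. Outside, the envelope times the exponential is 1, and a mixture
    density is at most 1. *)
Lemma envelope_dominates G1 G2 x : code G1 = code G2 ->
  mixture_density G1 x <=
    (mixture_density G2 x + env x) * expR (2 * L * log_tail S M n x).
Proof.
move=> G12; have g0 := mixture_density_ge0 G2 x.
have [xM|xM] := leP (set_dist S x) M.
  rewrite /log_tail xM mulr0 expR0 mulr1 /env excess_in// expr1n invr1 mulr1.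
  by have := code_close G12 xM; rewrite ler_norml => /andP[_]; lra.
apply: le_trans (mixture_density_le1 _ _) _.
suff E1 : env x * expR (2 * L * log_tail S M n x) = 1.
  by rewrite -[leLHS]E1 ler_wpM2r ?expR_ge0// lerDr.
rewrite /log_tail leNgt xM/= /env excess_out//.
have r0 : 0 < set_dist S x / M by rewrite divr_gt0// (lt_trans M0).
rewrite mulrDr mulr1 expRD.
have -> : 2 * L * (d.+1%:R / (2 * L) * ln (set_dist S x / M)) =
    d.+1%:R * ln (set_dist S x / M).
  by move: (ln (_ / M)) => l; field; exact: lt0r_neq0.
rewrite !expRM_natl (expR_ln_nat R n2) lnK ?posrE//.
have r1 : (set_dist S x / M) ^+ d.+1 != 0 by rewrite expf_neq0 ?gt_eqF.
by field; rewrite r1 gt_eqF.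
Qed.

(** The random density is replaced by a representative of its code, among those
    which are also far from f0. Its likelihood ratio is then at most the
    product of the ratios of (representative + envelope), times the product of
    e^(2 ln n * log_tail). If the whole is at least
    e^(-(alpha - beta) n T), then either the first product is at least
    e^(-alpha n T), or the second one at least e^(beta n T). The first event is
    bounded by the Chernoff bound with exponent 1/2, which produces the
    Hellinger affinity, and a union over the codes; the second one by the
    Chernoff bound with exponent 1 / (2 ln n). *)
Lemma hellinger_deviation (alpha beta T V a : R) :
  (\int[mu]_x (excess S M x ^- d.+1)%:E <= V%:E)%E ->
  (\int[mu]_x (expR (log_tail S M n x) * f0 x)%:E <= a%:E)%E ->
  measurable [set w | (T%:E <= hellinger2 (fhat (sample X w)) f0)%E] ->
  {ae P, forall w, (expR ((beta - alpha) * n%:R * T) <=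
    \prod_(i < n) (fhat (sample X w) (X i w) / f0 (X i w)))%R} ->
  (P [set w | (T%:E <= hellinger2 (fhat (sample X w)) f0)%E] <=
   (#|J|%:R * expR (- (1 - alpha) * n%:R * T / 2 + (1 + V) / 2) +
    expR (- beta * n%:R * T / (2 * L) + n%:R * (a - 1)))%:E)%E.
Proof.
move=> hV ha mA [N [mN PN sN]].
set A := [set w | _] in mA *.
pose good j G1 := code G1 = j /\ (T%:E <= hellinger2 (mixture_density G1) f0)%E.
(* The default Q is never used: E j is empty when no mixture of code j is far. *)
pose rep j : probability 'rV[R]_d R := xget Q (good j).
pose g j x := Num.sqrt ((mixture_density (rep j) x + env x) / f0 x).
pose E j := if `[< exists G1, good j G1 >] then
  [set w | expR (- alpha * n%:R * T / 2) <= \prod_(i < n) g j (X i w)] else set0.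
pose D := [set w | expR (beta * n%:R * T / (2 * L)) <=
  \prod_(i < n) expR (log_tail S M n (X i w))].
have mh (G1 : probability 'rV[R]_d R) : measurable_fun setT (mixture_density G1) := measurable_mixture_density G1.
have mg j : measurable_fun setT (g j).
  apply: measurable_sqrt_comp; apply: measurable_funM; first exact: measurable_funD.
  by apply: measurable_inv_pos => // x; exact: mixture_density_gt0.
have mlt : measurable_fun setT (fun x => expR (log_tail S M n x)).
  by apply: measurableT_comp => //; exact: measurable_log_tail.
have mprod (q : 'rV[R]_d -> R) b : measurable_fun setT q ->
    measurable [set w | expR b <= \prod_(i < n) q (X i w)].
  move=> mq; rewrite -[X in measurable X]setTI.
  apply: (measurable_fun_le (f := cst (expR b))) => //.
  by apply: measurable_prod => i _; exact: measurableT_comp.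
have mE j : measurable (E j) by rewrite /E; case: ifPn => // _; exact: mprod.
have mD : measurable D := mprod _ (beta * n%:R * T / (2 * L)) mlt.
have chern q b c mq q0 := @chernoff_product _ _ _ _ P _ X indepX
  (fun i => mixture_density (G i)) f0 q c b XG (fun i => mh (G i))
  (fun i => mixture_density_ge0 (G i)) GQ (mixture_density_ge0 Q) (mh Q) mq q0.
have PE j : (P (E j) <= (expR (- (1 - alpha) * n%:R * T / 2 + (1 + V) / 2))%:E)%E.
  rewrite /E; case: ifPn => [/asboolP ex|_]; last by rewrite measure0 lee_fin expR_ge0.
  have [_ TH] : good j (rep j) by exact: (xgetPex Q ex).
  have venv : (\int[mu]_x (env x)%:E <= (n%:R ^- 2 * V)%:E)%E.
    under eq_integral do rewrite /env EFinM.
    rewrite ge0_integralZl//; last 2 first.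
    - by apply/measurable_EFinP; exact: measurable_excessVX.
    - move=> x _; rewrite lee_fin invr_ge0 exprn_ge0//.
      exact: le_trans (excess_ge1 S M x).
    by rewrite EFinM lee_wpmul2l// lee_fin.
  have := perturbed_affinity (ltnW n2) measurable_env env_ge0 venv TH.
  move=> /(chern (g j) (- alpha * n%:R * T / 2) _ (mg j) (fun x => sqrtr_ge0 _)).
  move=> /le_trans; apply.
  rewrite lee_fin ler_expR.
  rewrite le_eqVlt; apply/orP; left; apply/eqP; field; rewrite gt_eqF//.
have PD : (P D <= (expR (- beta * n%:R * T / (2 * L) + n%:R * (a - 1)))%:E)%E.
  apply: le_trans (chern _ _ _ mlt (fun x => expR_ge0 _) ha) _.
  by rewrite lee_fin ler_expR !mulNr.
pose A' := A `\` (N `|` D).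
have mA' : measurable A' by apply: measurableD => //; exact: measurableU.
have PA' : (P A' <= \sum_j P (E j))%E.
  apply: measure_le_sum => // w [Aw ND].
  have wN : ~ N w by move=> ?; apply: ND; left.
  have wD : ~ D w by move=> ?; apply: ND; right.
  have [G1 fG] := fhat_mix (sample X w).
  have gG : good (code G1) G1 by split=> //; rewrite -fG.
  have ex : exists G2, good (code G1) G2 by exists G1.
  exists (code G1); rewrite /E asboolT//=.
  have [cG TH] : good (code G1) (rep (code G1)) by exact: (xgetPex Q ex).
  set j := code G1.
  rewrite leNgt; apply/negP => lt1.
  have lt2 : \prod_(i < n) expR (log_tail S M n (X i w)) < expR (beta * n%:R * T / (2 * L)).
    by rewrite ltNge; apply/negP.
  apply: wN; apply: sN => /=; apply/negP; rewrite -ltNge fG.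
  apply: (@le_lt_trans _ _ (\prod_(i < n)
     ((mixture_density (rep j) (X i w) + env (X i w)) / f0 (X i w) *
      expR (2 * L * log_tail S M n (X i w))))).
    apply: ler_prod => i _; rewrite divr_ge0 ?mixture_density_ge0//=.
    rewrite mulrAC ler_pM2r ?invr_gt0 ?mixture_density_gt0//.
    exact: envelope_dominates.
  rewrite big_split/= -expR_sum -mulr_sumr.
  have -> : expR ((beta - alpha) * n%:R * T) =
      expR (- alpha * n%:R * T / 2) ^+ 2 * expR (beta * n%:R * T).
    by rewrite -expRM_natl -expRD; congr expR; lra.
  apply: ltr_pM.
  - rewrite prodr_ge0// => i _; rewrite divr_ge0 ?mixture_density_ge0//.
    by rewrite addr_ge0// mixture_density_ge0.
  - exact: expR_ge0.
  - rewrite (_ : \prod_(i < n) _ = (\prod_(i < n) g j (X i w)) ^+ 2); last first.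
      rewrite -prodrXl; apply: eq_bigr => i _; rewrite sqr_sqrtr// divr_ge0 ?mixture_density_ge0//.
      by rewrite addr_ge0// mixture_density_ge0.
    rewrite ltr_sqr ?nnegrE ?expR_ge0// prodr_ge0// => i _; exact: sqrtr_ge0.
  - rewrite ltr_expR mulrC -ltr_pdivlMr ?mulr_gt0//.
    by rewrite -ltr_expR expR_sum.
have sA : A `<=` N `|` (D `|` A').
  move=> w Aw; have [Nw|Nw] := pselect (N w); first by left.
  by have [Dw|Dw] := pselect (D w); right; [left|right; split => // -[]].
apply: (@le_trans _ _ (P (N `|` (D `|` A')))).
  by apply: le_measure => //; rewrite inE//; apply: measurableU => //; exact: measurableU.
apply: le_trans (measureU2 _ mN (measurableU _ _ mD mA')) _.
rewrite [X in (X + _)%E]PN add0e.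
apply: le_trans (measureU2 _ mD mA') _.
rewrite addrC EFinD leeD//.
apply: le_trans PA' _; rewrite -sum1_card natr_sum mulr_suml -sumEFin.
by apply: lee_sum => j _; rewrite mul1r.
Qed.

End deviation.

(** * From tail bounds to expectations *)

Section hellinger_measurable.
Context (R : realType) (d : nat) (disp : measure_display)
  (Omega : measurableType disp) (P : probability Omega R) (n : nat).
Variables (X : 'I_n -> {RV P >-> 'rV[R]_d}).

Lemma measurable_sample : measurable_fun setT (sample X).
Proof.
apply/measurable_fun_tnthP => i.
rewrite (_ : _ \o _ = X i); first exact: measurable_funPT.
by apply/funext => w /=; rewrite tnth_mktuple.
Qed.

Lemma measurable_hellinger2_sample (fhat : n.-tuple 'rV[R]_d -> 'rV[R]_d -> R)
    (f0 : 'rV[R]_d -> R) :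
  mixture_estimator fhat -> measurable_fun setT f0 ->
  measurable_fun setT (fun w => hellinger2 (fhat (sample X w)) f0).
Proof.
move=> [mfhat _] mf0.
apply: (measurableT_comp (f := fun x => hellinger2 (fhat x) f0)); last exact: measurable_sample.
apply: (measurable_fun_fubini_tonelli_F (fun z : n.-tuple 'rV[R]_d * 'rV[R]_d =>
  ((Num.sqrt (fhat z.1 z.2) - Num.sqrt (f0 z.2)) ^+ 2)%:E)).
  apply/measurable_EFinP; apply: measurable_funX; apply: measurable_funB.
    exact: (measurableT_comp (@measurable_sqrtr R) mfhat).
  apply: (measurableT_comp (@measurable_sqrtr R)).
  exact: (measurableT_comp mf0 measurable_snd).
by move=> z; rewrite lee_fin sqr_ge0.
Qed.

End hellinger_measurable.

Lemma sum_lt_minn K j : (\sum_(k < K) (k < j))%N = minn K j.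
Proof.
elim: K => [|K IH]; first by rewrite big_ord0 min0n.
rewrite big_ord_recr/= IH; case: (ltnP K j) => Kj /=.
  by rewrite addn1; apply/esym/minn_idPl.
by rewrite addn0; apply/esym/minn_idPr; exact: leqW.
Qed.

(** H <= g (1 + the number of k >= 1 such that H >= k g), and the probabilities
    2 n^-k <= 2^(1 - k) add up to at most 2. *)
Lemma expectation_step_bound (R : realType) (disp : measure_display)
    (Omega : measurableType disp) (P : probability Omega R)
    (H : Omega -> \bar R) (g B : R) (n : nat) :
  (2 <= n)%N -> 0 < g -> measurable_fun setT H -> (forall w, 0 <= H w)%E ->
  (forall w, H w <= B%:E)%E ->
  (forall k, (1 <= k)%N -> P [set w | (k%:R * g)%:E <= H w] <= (2 * n%:R ^- k)%:E)%E ->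
  (\int[P]_w H w <= (3 * g)%:E)%E.
Proof.
move=> n2 g0 mH H0 HB HP.
(* Since H is bounded by B, finitely many steps are enough. *)
pose K := (Num.truncn (B / g)).+1.
pose A k := [set w | (k.+1%:R * g)%:E <= H w]%E.
have mA k : measurable (A k).
  rewrite -[X in measurable X]setTI.
  exact: emeasurable_fun_c_infty.
have mi k : measurable_fun setT (fun w => (\1_(A k) w)%:E : \bar R).
  by apply/measurable_EFinP; exact: measurable_indic.
apply: (@le_trans _ _ (\int[P]_w (g%:E + \sum_(k < K) g%:E * (\1_(A k) w)%:E))%E).
  apply: ge0_le_integral => //.
  - apply: emeasurable_funD => //; apply: emeasurable_sum => k.
    exact: emeasurable_funM.
  - move=> w _; under eq_bigr do rewrite -EFinM.
    rewrite sumEFin -EFinD -mulr_sumr.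
    have := HB w; have := H0 w; case E : (H w) => [h| |]//; rewrite !lee_fin => h0 hB.
    pose j := Num.truncn (h / g).
    have hg0 : 0 <= h / g by rewrite divr_ge0// ltW.
    have hj : h <= (j%:R + 1) * g.
      by rewrite -ler_pdivrMr// natr1 ltW// truncnS_gt.
    have jK : (j <= K)%N.
      by rewrite ltnW// ltnS le_truncn// ler_pM2r ?invr_gt0.
    suff -> : \sum_(k < K) \1_(A k) w = j%:R :> R by apply: le_trans hj _; lra.
    rewrite -(minn_idPr jK) -sum_lt_minn natr_sum; apply: eq_bigr => k _.
    rewrite indicE; congr (_%:R); congr nat_of_bool.
    rewrite truncn_gt_nat ler_pdivlMr//; apply/idP/idP.
      by move=> /set_mem; rewrite /A/= E lee_fin.
    by move=> ?; apply/mem_set; rewrite /A/= E lee_fin.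
rewrite ge0_integralD//; last 3 first.
- by move=> w _; rewrite lee_fin ltW.
- by move=> w _; apply: sume_ge0 => k _; rewrite mule_ge0 ?lee_fin// ltW.
- by apply: emeasurable_sum => k; exact: emeasurable_funM.
rewrite integral_cst_prob ge0_integral_sum//; last 2 first.
- by move=> k; exact: emeasurable_funM.
- by move=> k w _; rewrite mule_ge0 ?lee_fin// ltW.
apply: (@le_trans _ _ (g%:E + \sum_(k < K) (g * (2 * 2 ^- k.+1))%:E)%E).
  rewrite leeD2l//; apply: lee_sum => k _.
  rewrite ge0_integralZl ?lee_fin ?(ltW g0)// integral_indic// setIT EFinM.
  apply: lee_wpmul2l; first by rewrite lee_fin ltW.
  apply: le_trans (HP k.+1 isT) _.
  rewrite lee_fin ler_pM2l// lef_pV2 ?posrE ?exprn_gt0 ?ltr0n ?(ltn_trans _ n2)//.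
  by rewrite lerXn2r ?nnegrE// (ler_nat R 2).
rewrite sumEFin -EFinD lee_fin -mulr_sumr -mulr_sumr.
suff -> : \sum_(k < K) (2 : R) ^- k.+1 = 1 - 2 ^- K.
  have : 0 <= (2 : R) ^- K by rewrite invr_ge0 exprn_ge0.
  by move: (_ ^- K) => b b0; nra.
elim: K => [|k IH]; first by rewrite big_ord0 expr0 invr1 subrr.
by rewrite big_ord_recr/= IH exprS invfM; lra.
Qed.

(** * Constants and the deviation inequality *)

Section exponents.
Context (R : realType) (d : nat).
Hypothesis d0 : (0 < d)%N.

(** F is n times the volume term of the squared rate. Since Vol(S^1) >= d^-d and
    M is at least the square root of ln n, it dominates every term of smaller
    order which appears in the exponents. *)
Lemma leading_term_bounds (n : nat) (M V : R) : (2 <= n)%N ->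
  Num.sqrt (ln n%:R) <= M -> 2 <= M -> 1 <= d%:R ^+ d * V ->
  let F := V * M ^+ d * Num.sqrt (ln n%:R) ^+ (d + 2) in
  [/\ V * M ^+ d <= 2 ^+ (d + 2) * F,
      1 <= d%:R ^+ d * 2 ^+ (d + 2) * F,
      ln n%:R <= 2 * (2 * d%:R) ^+ d * F &
      ln n%:R ^+ 2 <= 2 * (2 * d%:R) ^+ d * F].
Proof.
move=> n2; set L := ln n%:R; set a := Num.sqrt L => aM M2 dV F.
have L1 : 2^-1 <= L := ln_nat_ge_half R n2.
have aL : a ^+ 2 = L by rewrite sqr_sqrtr//; lra.
have a0 : 0 < a by rewrite sqrtr_gt0; lra.
have a2 : 1 <= 2 * a by have : 0 <= a := ltW a0; nra.
have dd0 : 0 < d%:R ^+ d :> R by rewrite exprn_gt0// ltr0n.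
have V0 : 0 < V by rewrite -(pmulr_rgt0 _ dd0) (lt_le_trans _ dV).
have M0 : 0 <= M by lra.
have Md : 1 <= M ^+ d by rewrite exprn_ege1//; lra.
have h1 : V * M ^+ d <= 2 ^+ (d + 2) * F.
  rewrite /F mulrCA -exprMn ler_peMr ?exprn_ege1//.
  by rewrite mulr_ge0// ltW// (lt_le_trans _ Md).
have h2 : 1 <= d%:R ^+ d * 2 ^+ (d + 2) * F.
  rewrite -mulrA (le_trans dV)// ler_wpM2l ?(ltW dd0)// (le_trans _ h1)//.
  by rewrite ler_peMr// ltW.
have F0 : 0 <= F by rewrite !mulr_ge0 ?exprn_ge0 ?(ltW V0) ?(ltW a0).
have h3 : L ^+ d.+1 <= d%:R ^+ d * F.
  have -> : L ^+ d.+1 = a ^+ d * a ^+ (d + 2).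
    by rewrite -aL -exprM -exprD; congr (_ ^+ _); rewrite mulnS mul2n -addnn addnC -addnA.
  rewrite /F mulrA ler_wpM2r ?exprn_ge0 ?(ltW a0)//.
  apply: (@le_trans _ _ (M ^+ d)); first by rewrite lerXn2r ?nnegrE// ltW.
  by rewrite mulrA ler_peMl// (le_trans _ Md).
have L2 : 1 <= 2 * L by lra.
have L0 : 0 <= L by lra.
have h4 : 2 ^+ d * L ^+ d.+1 <= (2 * d%:R) ^+ d * F.
  by rewrite exprMn -mulrA ler_wpM2l// exprn_ge0.
have h5 : L <= 2 ^+ d * L ^+ d.+1.
  by rewrite exprSr mulrA -exprMn ler_peMl// exprn_ege1.
have h6 : L ^+ 2 <= 2 * (2 ^+ d * L ^+ d.+1).
  case: d d0 => // d' _; rewrite !exprSr.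
  have : 1 <= (2 * L) ^+ d' by rewrite exprn_ege1.
  rewrite exprMn; move: (2 ^+ d') (L ^+ d') => u w uw.
  have := ler_wpM2r (mulr_ge0 L0 L0) uw; rewrite expr0 mul1r.
  have := mulr_ge0 L0 L0; nra.
have D0 : 0 <= (2 * d%:R) ^+ d * F by rewrite mulr_ge0// exprn_ge0// mulr_ge0.
by split => //; rewrite -mulrA; lra.
Qed.

End exponents.

(** The coefficients of the volume and of the infimum are positive, so the sum
    can only be finite if both are. *)
Lemma epsilon2_fin (R : realType) d n (M : R) (S : set 'rV[R]_d)
    (G : {measure set 'rV[R]_d -> \bar R}) (e2 : R) :
  (2 <= n)%N -> 0 < M -> epsilon2 n M S G = e2%:E ->
  exists V I : R, [/\ @lebesgue_rV R d (enlargement1 S) = V%:E,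
    ereal_inf [set (((2 / M)%:E * moment S G p) `^ p)%E
      | p in [set p : R | d.+1%:R / (2 * ln n%:R) <= p]] = I%:E, 0 <= I &
    n%:R * e2 = V * M ^+ d * Num.sqrt (ln n%:R) ^+ (d + 2) + n%:R * (ln n%:R * I)].
Proof.
move=> n2 M0; rewrite /epsilon2; set L := ln n%:R; set a := Num.sqrt L.
set W := lebesgue_rV R d _; set J := ereal_inf _.
have L0 : 0 < L by apply: lt_le_trans (ln_nat_ge_half R n2); rewrite invr_gt0.
have a0 : 0 < a by rewrite sqrtr_gt0.
have nR : 0 < n%:R :> R by rewrite ltr0n (ltn_trans _ n2).
have J0 : (0 <= J)%E by apply: le_ereal_inf_tmp => _ [p _ <-]; exact: poweR_ge0.
have W0 : (0 <= W)%E by exact: measure_ge0.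
have r0 : 0 < M ^+ d / n%:R * a ^+ (d + 2) by rewrite mulr_gt0 ?divr_gt0 ?exprn_gt0.
move: J0 W0; case: W => [V| |]//; case: J => [I| |]//=; rewrite ?lee_fin => I0 V0 E.
- exists V, I; split => //; move: E; rewrite -!EFinM -EFinD => -[<-].
  by field; rewrite gt_eqF.
- by move: E; rewrite gt0_muley ?lte_fin// addey.
- by move: E; rewrite gt0_mulye ?lte_fin//.
- by move: E; rewrite gt0_mulye ?lte_fin// gt0_muley ?lte_fin.
Qed.

(** At T = t^2 C epsilon^2 / min(1 - alpha, beta), both exponents of
    hellinger_deviation fall below -t^2 ln n. In C, the constant C1 pays for the
    entropy and for the envelope, C2 for the tail and c2 for t^2 ln n. The
    likelihood assumption, made at t = 1, implies the one at t as
    beta <= alpha. *)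
Lemma hellinger_tail (R : realType) d : (0 < d)%N ->
  exists2 C : R, 0 < C &
  forall (n : nat) (disp : measure_display) (Omega : measurableType disp)
    (P : probability Omega R) (G : 'I_n -> probability 'rV[R]_d R)
    (X : 'I_n -> {RV P >-> 'rV[R]_d}) (M : R) (S : set 'rV[R]_d),
  (2 <= n)%N -> mutually_independent X ->
  (forall i, has_density (X i) (mixture_density (G i))) ->
  Num.sqrt (10 * ln n%:R) <= M -> S !=set0 -> compact S ->
  forall fhat : n.-tuple 'rV[R]_d -> 'rV[R]_d -> R, mixture_estimator fhat ->
  forall alpha beta : R, 0 < beta -> beta <= alpha -> alpha < 1 ->
  forall e2 : R, epsilon2 n M S (mean_measure G) = e2%:E ->
  {ae P, forall w, expR (C * (beta - alpha) / Num.min (1 - alpha) beta * n%:R * e2) <=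
     \prod_(i < n) (fhat (sample X w) (X i w)
                    / mixture_density (mean_measure G) (X i w))} ->
  0 < e2 /\ forall t, 1 <= t ->
    (P [set w | ((t ^+ 2 * (C / Num.min (1 - alpha) beta * e2))%:E <=
       hellinger2 (fhat (sample X w)) (mixture_density (mean_measure G)))%E] <=
     (2 * expR (- t ^+ 2 * ln n%:R))%:E)%E.
Proof.
move=> d0; have [Ce Ce0 entropy] := mixture_entropy R d0.
pose D : R := d%:R ^+ d.
pose k2 : R := 2 ^+ (d + 2).
pose c2 : R := 2 * (2 * d%:R) ^+ d.
pose K2 : R := expR 1 + expR 1 * tail_const R d * 3 ^+ d.
pose C1 : R := Ce + (D * k2 + 2 * D * 8 ^+ d * k2) / 2.
pose C2 : R := expR 1 + 2 * c2 * K2.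
have D0 : 0 <= D by rewrite exprn_ge0.
have k20 : 0 <= k2 by rewrite exprn_ge0.
have c20 : 0 < c2 by rewrite mulr_gt0// exprn_gt0// mulr_gt0// ltr0n.
have e10 : 0 < expR 1 :> R := expR_gt0 _.
have K20 : 0 <= K2.
  by rewrite addr_ge0 ?(ltW e10)// mulr_ge0 ?exprn_ge0// mulr_ge0 ?(ltW e10)// mulr_ge0// exprn_ge0.
have C10 : 0 <= C1.
  by rewrite addr_ge0 ?(ltW Ce0)// divr_ge0// addr_ge0 ?mulr_ge0.
have C20 : 0 <= C2 by rewrite addr_ge0 ?(ltW e10)// mulr_ge0// mulr_ge0// ltW.
exists (2 * (C1 + C2 + c2)); first by lra.
set C := 2 * (C1 + C2 + c2).
move=> n disp Omega P G X M S n2 indepX XG sM S0 cS fhat fhatM al be be0 beal al1 e2 He2 lik.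
set m := Num.min (1 - al) be in lik *.
have m0 : 0 < m by rewrite lt_min be0 andbT subr_gt0.
have mal : m <= 1 - al by rewrite ge_min lexx.
have mbe : m <= be by rewrite ge_min lexx orbT.
set L := ln n%:R.
have L1 : 2^-1 <= L := ln_nat_ge_half R n2.
have L0 : 0 < L by lra.
have nR : 0 < n%:R :> R by rewrite ltr0n (ltn_trans _ n2).
have M0 : 0 <= M by apply: le_trans sM; exact: sqrtr_ge0.
have ML : 10 * L <= M ^+ 2.
  rewrite -(@sqr_sqrtr _ (10 * L)); last by lra.
  by rewrite lerXn2r ?nnegrE ?sqrtr_ge0.
have M2 : 2 <= M by rewrite leNgt; apply/negP => M2; nra.
have aM : Num.sqrt L <= M.
  by rewrite -(ger0_norm M0) -sqrtr_sqr ler_wsqrtr//; lra.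
have Mgt0 : 0 < M by lra.
have [V [I [HV HI I0 nE]]] := epsilon2_fin n2 Mgt0 He2.
have [N [c [Sc NV]]] := unit_box_cover d0 S0 cS.
have NV' : N%:R <= D * V by move: NV; rewrite HV -EFinM lee_fin.
have N1 : 1 <= N%:R :> R.
  by case: S0 => u /Sc[j _]; rewrite ler1n; apply: leq_ltn_trans (ltn_ord j).
have DV : 1 <= D * V by exact: le_trans NV'.
have [] := leading_term_bounds d0 n2 aM M2 DV.
rewrite -/L -/k2 -/D -/c2; set F := V * M ^+ d * _ => F1 F2 F3 F4.
have F00 : 0 < F by rewrite -(pmulr_rgt0 _ c20) (lt_le_trans L0 F3).
have F0 : 0 <= F := ltW F00.
have Fe : F <= n%:R * e2 by rewrite nE lerDl mulr_ge0 ?ler0n// mulr_ge0// ltW.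
have e20 : 0 < e2 by rewrite -(pmulr_rgt0 _ nR); exact: lt_le_trans Fe.
split=> // t t1.
have t2 : 1 <= t ^+ 2 by rewrite exprn_ege1.
have [Q QG] := mean_measure_probability G (ltnW n2).
have fQ := eq_mixture_density QG.
have GQ x : \sum_(i < n) mixture_density (G i) x = n%:R * mixture_density Q x.
  by rewrite fQ mixture_density_mean// ltnW.
have [J [code [cclose cJ]]] := entropy n M V S n2 aM M2 S0 cS HV.
have envV := envelope_integral S0 M2 Sc.
set W := 2 * N%:R * (8 * M) ^+ d in envV.
(* The infimum may not be attained; an error of 1 / n in it adds a constant to the
   exponent, which is multiplied by n. *)
have [_ [p pp0 <-] Ip] : exists2 x, [set (((2 / M)%:E * moment S (mean_measure G) p) `^ p)%E
      | p in [set p : R | d.+1%:R / (2 * ln n%:R) <= p]] x & (x < I%:E + (n%:R^-1)%:E)%E.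
  by rewrite -HI; apply: lb_ereal_inf_adherent; rewrite ?invr_gt0// HI.
have p0 : 0 < p.
  by apply: lt_le_trans pp0; rewrite divr_gt0// mulr_gt0.
rewrite (moment_integral _ S0 Mgt0 p0) in Ip.
have HT := tail_integral S0 n2 M2 ML Q pp0.
pose a : R := 1 + expR 1 * (I + n%:R^-1) + expR 1 * tail_const R d * 3 ^+ d / n%:R.
have {}HT : (\int[@lebesgue_rV R d]_x
    (expR (log_tail S M n x) * mixture_density Q x)%:E <= a%:E)%E.
  apply: le_trans HT _; rewrite /a !EFinD leeD2r// leeD2l// EFinM lee_wpmul2l ?lee_fin ?(ltW e10)//.
  rewrite (eq_measure_integral (mean_measure G)); last by move=> A _ _; exact: QG.
  by rewrite EFinD; exact: ltW.
set T := t ^+ 2 * (C / m * e2).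
have mh2 := measurable_hellinger2_sample X fhatM (measurable_mixture_density Q).
have mA : measurable [set w | (T%:E <= hellinger2 (fhat (sample X w)) (mixture_density Q))%E].
  by rewrite -[X in measurable X]setTI; exact: emeasurable_fun_c_infty.
rewrite -fQ in lik *.
have C0 : 0 < C by rewrite /C; lra.
have lik' : {ae P, forall w, (expR ((be - al) * n%:R * T) <=
    \prod_(i < n) (fhat (sample X w) (X i w) / mixture_density Q (X i w)))%R}.
  apply: filterS lik => w; apply: le_trans; rewrite ler_expR.
  have -> : C * (be - al) / m * n%:R * e2 = - ((al - be) * (n%:R * (C / m * e2))) by lra.
  have -> : (be - al) * n%:R * T = - (t ^+ 2 * ((al - be) * (n%:R * (C / m * e2)))).
    by rewrite /T; lra.
  have g0 : 0 <= n%:R * (C / m * e2).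
    by rewrite mulr_ge0// mulr_ge0 ?(ltW e20)// divr_ge0 ?(ltW C0) ?(ltW m0).
  by rewrite lerN2 ler_peMl// mulr_ge0 ?subr_ge0.
apply: le_trans (hellinger_deviation n2 S0 M2 indepX XG GQ (proj2 fhatM) cclose envV HT mA lik') _.
rewrite lee_fin.
have TC b : m <= b -> t ^+ 2 * C * (n%:R * e2) <= b * n%:R * T.
  move=> mb; rewrite /T; apply: (@le_trans _ _ (m * n%:R * (t ^+ 2 * (C / m * e2)))).
    by rewrite le_eqVlt; apply/orP; left; apply/eqP; field; rewrite gt_eqF.
  have z : 0 <= n%:R * (t ^+ 2 * (C / m * e2)).
    rewrite mulr_ge0// mulr_ge0 ?sqr_ge0// mulr_ge0 ?(ltW e20)//.
    by rewrite divr_ge0 ?(ltW C0) ?(ltW m0).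
  by rewrite -(mulrA m) -(mulrA b) ler_wpM2r.
have Wle : W <= 2 * D * 8 ^+ d * k2 * F.
  rewrite /W exprMn.
  have : N%:R * M ^+ d <= D * (k2 * F).
    apply: (@le_trans _ _ (D * V * M ^+ d)); first by rewrite ler_wpM2r// exprn_ge0.
    by rewrite -mulrA ler_wpM2l.
  have : 0 <= 2 * 8 ^+ d :> R by rewrite mulr_ge0// exprn_ge0.
  move=> h8 /(ler_wpM2l h8); lra.
have b1 : #|J|%:R * expR (- (1 - al) * n%:R * T / 2 + (1 + W) / 2) <= expR (- t ^+ 2 * L).
  apply: (@le_trans _ _ (expR (Ce * F) * expR (- (1 - al) * n%:R * T / 2 + (1 + W) / 2))).
    by rewrite ler_wpM2r ?expR_ge0.
  rewrite -expRD ler_expR.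
  have h := TC _ mal.
  have hF : t ^+ 2 * C * F <= t ^+ 2 * C * (n%:R * e2).
    by rewrite ler_wpM2l// mulr_ge0 ?(ltW C0)// sqr_ge0.
  have hL : t ^+ 2 * L <= t ^+ 2 * (c2 * F) by rewrite ler_wpM2l// sqr_ge0.
  have hC1 : C1 * F <= t ^+ 2 * (C1 * F) by rewrite ler_peMl// mulr_ge0.
  have hC2 : 0 <= t ^+ 2 * (C2 * F) by rewrite mulr_ge0 ?sqr_ge0// mulr_ge0.
  have : (1 + W) / 2 + Ce * F <= C1 * F by rewrite /C1; lra.
  move: h hF; rewrite /C; lra.
have b2 : expR (- be * n%:R * T / (2 * L) + n%:R * (a - 1)) <= expR (- t ^+ 2 * L).
  rewrite ler_expR.
  have -> : n%:R * (a - 1) = expR 1 * (n%:R * I) + K2.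
    by rewrite /a /K2; field; rewrite gt_eqF.
  rewrite -(ler_pM2r L0).
  have -> : (- be * n%:R * T / (2 * L) + (expR 1 * (n%:R * I) + K2)) * L =
     - (be * n%:R * T) / 2 + expR 1 * (n%:R * (L * I)) + K2 * L.
    by field; rewrite gt_eqF.
  have h := TC _ mbe; set E := n%:R * e2 in h nE Fe *.
  have hI : n%:R * (L * I) <= E by rewrite nE lerDr.
  have hK : K2 * L <= 2 * c2 * K2 * F.
    have : L <= 2 * (c2 * F) by have := F4; rewrite expr2; nra.
    by move=> /(ler_wpM2l K20); lra.
  have E0 : 0 <= E by exact: le_trans Fe.
  have hC2 : C2 * E <= t ^+ 2 * (C2 * E) by rewrite ler_peMl// mulr_ge0.
  have hC1 : 0 <= t ^+ 2 * (C1 * E) by rewrite mulr_ge0 ?sqr_ge0// mulr_ge0.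
  have hL : t ^+ 2 * L ^+ 2 <= t ^+ 2 * (c2 * E).
    rewrite ler_wpM2l ?sqr_ge0//; apply: le_trans F4 _.
    by rewrite ler_wpM2l// ltW.
  have h1 : expR 1 * (n%:R * (L * I)) <= expR 1 * E by rewrite ler_pM2l.
  have h2 : 2 * c2 * K2 * F <= 2 * c2 * K2 * E.
    by rewrite ler_wpM2l// mulr_ge0// mulr_ge0// ltW.
  have : expR 1 * (n%:R * (L * I)) + K2 * L <= C2 * E by rewrite /C2; lra.
  move: h; rewrite /C; lra.
lra.
Qed.

Theorem theorem2p1 (R : realType) (d : nat) (hd : (1 <= d)%N) :
  exists C : R, 0 < C /\
  forall (n : nat) (disp : measure_display) (Omega : measurableType disp)
    (P : probability Omega R) (G : 'I_n -> probability 'rV[R]_d R)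
    (X : 'I_n -> {RV P >-> 'rV[R]_d}) (M : R) (S : set 'rV[R]_d),
  (2 <= n)%N ->
  mutually_independent X ->
  (forall i, has_density (X i) (mixture_density (G i))) ->
  Num.sqrt (10 * ln n%:R) <= M ->
  S !=set0 -> compact S ->
  forall fhat : n.-tuple 'rV[R]_d -> 'rV[R]_d -> R, mixture_estimator fhat ->
  forall alpha beta : R, 0 < beta -> beta <= alpha -> alpha < 1 ->
  {ae P, forall w,
    (expeR ((C * (beta - alpha) / Num.min (1 - alpha) beta * n%:R)%:E
            * epsilon2 n M S (mean_measure G))
     <= (\prod_(i < n) (fhat (sample X w) (X i w)
                        / mixture_density (mean_measure G) (X i w)))%:E)%E} ->
  (forall t : R, 1 <= t ->
    (P [set w | (t * Num.sqrt C / Num.sqrt (Num.min (1 - alpha) beta))%:E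
                * epsilon n M S (mean_measure G)
                <= hellinger (fhat (sample X w))
                             (mixture_density (mean_measure G))]
     <= (2 * n%:R `^ (- t ^+ 2))%:E)%E) /\
  (\int[P]_w hellinger2 (fhat (sample X w)) (mixture_density (mean_measure G))
   <= (4 * C / Num.min (1 - alpha) beta)%:E
      * epsilon2 n M S (mean_measure G))%E.
Proof.
have [C C0 tail] := hellinger_tail R hd; exists C; split => //.
move=> n disp Omega P G X M S n2 indepX XG sM S0 cS fhat fhatM al be be0 beal al1 lik.
have m0 : 0 < Num.min (1 - al) be by rewrite lt_min be0 andbT subr_gt0.
have [Q QG] := mean_measure_probability G (ltnW n2).
have fQ := eq_mixture_density QG.
have nR : 0 < n%:R :> R by rewrite ltr0n (ltn_trans _ n2).
have powE t : n%:R `^ (- t ^+ 2) = expR (- t ^+ 2 * ln n%:R) :> R.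
  by rewrite /powR gt_eqF.
have H2 w : (hellinger2 (fhat (sample X w)) (mixture_density (mean_measure G)) <= 2%:E)%E.
  by have [G1 ->] := fhatM.2 (sample X w); rewrite -fQ; exact: hellinger2_le2.
have cgt0 t : 1 <= t -> 0 < t * Num.sqrt C / Num.sqrt (Num.min (1 - al) be).
  move=> t1; rewrite divr_gt0 ?sqrtr_gt0// mulr_gt0 ?sqrtr_gt0//.
  exact: lt_le_trans t1.
have epsilon2_ge0 : (0 <= epsilon2 n M S (mean_measure G))%E.
  have M0 : 0 <= M by apply: le_trans sM; exact: sqrtr_ge0.
  rewrite adde_ge0 ?mule_ge0 ?measure_ge0// ?lee_fin.
  - by rewrite mulr_ge0 ?divr_ge0 ?exprn_ge0 ?sqrtr_ge0// ltW.
  - by rewrite ln_ge0// ler1n ltnW.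
  - by apply: le_ereal_inf_tmp => _ [p _ <-]; exact: poweR_ge0.
move: lik (tail n disp Omega P G X M S n2 indepX XG sM S0 cS fhat fhatM al be be0 beal al1).
rewrite /epsilon; move: epsilon2_ge0.
case: (epsilon2 n M S (mean_measure G)) => [e2| |]//= e2ge0 lik tl; last first.
  split=> [t t1|].
    rewrite (_ : [set w | _] = set0) ?measure0.
      by rewrite lee_fin mulr_ge0// powR_ge0.
    apply/seteqP; split => // w /=; rewrite gt0_muley ?lte_fin ?cgt0//.
    rewrite leye_eq => /eqP hoo; have := H2 w.
    have : hellinger2 (fhat (sample X w)) (mixture_density (mean_measure G)) \is a fin_num.
      by rewrite ge0_fin_numE ?hellinger2_ge0// (le_lt_trans (H2 w))// ltry.
    by rewrite -sqrte_fin_num ?hellinger2_ge0// [sqrte _]hoo.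
  by rewrite gt0_muley ?leey// lte_fin divr_gt0// mulr_gt0.
have {}lik : {ae P, forall w, expR (C * (be - al) / Num.min (1 - al) be * n%:R * e2) <=
     \prod_(i < n) (fhat (sample X w) (X i w)
                    / mixture_density (mean_measure G) (X i w))}.
  by apply: filterS lik => w; rewrite lee_fin.
have [e20 {}tl] := tl e2 erefl lik.
split=> [t t1|].
  rewrite powE; apply: le_trans (tl t t1); rewrite le_eqVlt; apply/orP; left; apply/eqP.
  set c := t * Num.sqrt C / _.
  have sqc : t ^+ 2 * (C / Num.min (1 - al) be * e2) = c ^+ 2 * e2.
    by rewrite /c !exprMn exprVn !sqr_sqrtr ?(ltW C0) ?(ltW m0)//; lra.
  have threshold : (c * Num.sqrt e2)%:E = sqrte (c ^+ 2 * e2)%:E.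
    by rewrite /= sqrtrM ?sqr_ge0// sqrtr_sqr ger0_norm// ltW// cgt0.
  congr (P _); apply/seteqP; split => w /=;
    by rewrite -EFinM threshold sqc lee_sqrt ?hellinger2_ge0.
set g := C / Num.min (1 - al) be * e2.
have g0 : 0 < g by rewrite mulr_gt0// divr_gt0.
apply: (@le_trans _ _ (3 * g)%:E); last first.
  by rewrite -EFinM lee_fin [leRHS](_ : _ = 4 * g) ?ler_pM2r ?ler_nat// /g; lra.
apply: (expectation_step_bound n2 g0 _ _ H2).
- by rewrite -fQ; apply: measurable_hellinger2_sample => //; exact: measurable_mixture_density.
- by move=> w; exact: hellinger2_ge0.
move=> k k1.
have := tl (Num.sqrt k%:R); rewrite sqr_sqrtr// => /(_ _)/le_trans; apply.
  by rewrite -[leLHS]sqrtr1 ler_sqrt ?ler1n.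
by rewrite mulNr expRN expRM_natl lnK ?posrE.
Qed.
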